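(* Let $\mathfrak b\in[\mathbb H^\infty_d]_1$ be NC rational with $\mathfrak b(0)=0$, let $\zeta\in\partial\mathbb D$, and let $A_\zeta^*=T(\zeta)^*|_{\mathcal K}$ be a column-isometric restriction of $T(\zeta)^*$ to a non-zero invariant subspace $\mathcal K\subseteq\mathscr M(\mathfrak b)$. Then $\zeta$ is an eigenvalue of $\mathfrak b(A_\zeta^{\mathrm t})$.
   Context: Fix $d\in\mathbb N$. $\mathbb F^d$ is the free monoid of words in $1,\dots,d$ with unit $\emptyset$; for $\omega=i_1\cdots i_m$, $\omega^{\mathrm t}:=i_m\cdots i_1$, and $A^\omega:=A_{i_1}\cdots A_{i_m}$, $A^{*\omega}:=(A^\omega)^*$ for a $d$-tuple $A$ of operators. $\bigvee$ denotes closed linear span; inner products are linear in the second variable. $\mathbb H^2_d$ is the Hilbert space of power series $\sum_\omega\hat h_\omega\mathfrak z^\omega$ in non-commuting variables $\mathfrak z_1,\dots,\mathfrak z_d$ with square-summable coefficients; $L_k$ is left multiplication by $\mathfrak z_k$; $U_{\mathrm t}\mathfrak z^\omega=\mathfrak z^{\omega^{\mathrm t}}$ is unitary and $h^{\mathrm t}:=U_{\mathrm t}h$. $\mathbb B^d_{\mathbb N}=\bigsqcup_n\mathbb B^d_n$, $\mathbb B^d_n$ the set of $d$-tuples $Z$ of $n\times n$ matrices with $\sum_jZ_jZ_j^*<I_n$. $\mathbb H^\infty_d$ is the algebra of NC functions uniformly bounded on $\mathbb B^d_{\mathbb N}$, identified isometrically with the left multipliers $F(L):h\mapsto F\cdot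 h$ of $\mathbb H^2_d$; $F(R):=U_{\mathrm t}F(L)U_{\mathrm t}$ is right multiplication by $F^{\mathrm t}$; $[\mathbb H^\infty_d]_1$ is the closed unit ball. An NC rational function is an equivalence class of expressions built from the variables, scalars, $+,\cdot,{}^{-1}$ (equivalent if equal on common domains of matrix tuples of all sizes), with domain $\mathrm{Dom}$ the union of the domains of its representatives; $\mathfrak b\in\mathbb H^\infty_d$ is NC rational if it is given by such a function. The right free de Branges--Rovnyak space $\mathscr H^{\mathrm t}(\mathfrak b)$ is $\mathrm{Ran}\sqrt{I-\mathfrak b(R)\mathfrak b(R)^*}$ with the norm making $\sqrt{I-\mathfrak b(R)\mathfrak b(R)^*}$ a co-isometry onto its range; it is $L_k^*$-invariant and contains $L_k^*\mathfrak b^{\mathrm t}$. Since $\mathfrak b(0)=0$ it contains $1$ (which is its evaluation vector at $0$). Put $\mathscr M(\mathfrak b):=\mathbb C1+\bigvee_{\omega\ne\emptyset}L^{*\omega}\mathfrak b^{\mathrm t}\subseteq\mathscr H^{\mathrm t}(\mathfrak b)$, a finite-dimensional space. For $\zeta\in\mathbb C$, $T(\zeta)=(T(\zeta)_1,\dots,T(\zeta)_d)$ is the $d$-tuple on $\mathscr M(\mathfrak b)$ given by $T(\zeta)_k^*h=L_k^*h+\overline\zeta\,\langle1,h\rangle_{\mathscr H^{\mathrm t}(\mathfrak b)}L_k^*\mathfrak b^{\mathrm t}$; for $\zeta\in\partial\mathbb D$ it is a row contraction. A subspace $\mathcal K$ is $T(\zeta)^*$-invariant if invariant for every $T(\zeta)_k^*$,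 and $T(\zeta)^*|_{\mathcal K}$ is column-isometric if $\sum_k\|T(\zeta)_k^*h\|^2=\|h\|^2$ for $h\in\mathcal K$; then $A_\zeta=(A_{\zeta,1},\dots,A_{\zeta,d})$ with $A_{\zeta,k}^*=T(\zeta)_k^*|_{\mathcal K}$. $A_\zeta^{\mathrm t}=(A_{\zeta,1}^{\mathrm t},\dots,A_{\zeta,d}^{\mathrm t})$ denotes the matrix transposes with respect to a choice of orthonormal basis of $\mathcal K$; $A_\zeta^{\mathrm t}$ lies in $\mathrm{Dom}\,\mathfrak b$. *)

(* Defs.v *)
(* MathComp-Analysis world: R : realType, complex scalars R[i]. *)
From HB Require Import structures.
From mathcomp Require Import all_boot all_order all_algebra.
From mathcomp Require Import all_classical all_reals all_analysis.
From mathcomp Require Import complex.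

Set Implicit Arguments.
Unset Strict Implicit.
Unset Printing Implicit Defensive.

Import Order.TTheory GRing.Theory Num.Theory.
Import numFieldNormedType.Exports.
Local Open Scope ring_scope.
Local Open Scope classical_set_scope.
Local Open Scope sesquilinear_scope.

(* A formal power series in d non-commuting variables, given by its
   coefficients; a word i_1 ... i_m is the list [:: i_1; ...; i_m]. Linear
   operations are the pointwise ones on functions. *)
Notation fps R d := (seq 'I_d -> R[i]).

(** ** The free Hardy space *)

(* Sums over words are limits of the sums over words of length < m. The family
   is absolutely summable both in [l2] and in [ip] on [l2], so the order of
   summation is immaterial there. The cast to R[i]^o selects the topology of
   the norm. *)
Definition word_psum (R : realType) (d : nat) (F : seq 'I_d -> R[i]) :
    nat -> R[i]^o :=
  fun m => \sum_(k < m) \sum_(w : k.-tuple 'I_d) F w.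

Definition l2 (R : realType) (d : nat) : set (fps R d) :=
  [set h | cvgn (word_psum (fun w => `|h w| ^+ 2))].

(* linear in the second variable *)
Definition ip (R : realType) (d : nat) (f g : fps R d) : R[i] :=
  limn (word_psum (fun w => (f w)^* * g w)).

Definition mono (R : realType) (d : nat) (w : seq 'I_d) : fps R d :=
  fun v => (v == w)%:R.
Arguments mono : clear implicits.

(* Operators on the free Hardy space are represented by maps on all formal
   power series, of which only the restriction to l2 matters. *)
Notation fop R d := (fps R d -> fps R d).

(* The adjoint: <z^w, X^* h> = <X z^w, h>. *)
Definition adj (R : realType) (d : nat) (X : fop R d) : fop R d :=
  fun h w => ip (X (mono R d w)) h.

Definition bounded_op (R : realType) (d : nat) (X : fop R d) : Prop :=
  [/\ forall f, l2 f -> l2 (X f),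
      forall (a : R[i]) f g, l2 f -> l2 g -> X (a *: f + g) = a *: X f + X g
    & exists c : R[i], forall f, l2 f -> ip (X f) (X f) <= c * ip f f].

(* x >= 0 on complex numbers means that x is real and nonnegative. *)
Definition positive_op (R : realType) (d : nat) (X : fop R d) : Prop :=
  (forall f g, l2 f -> l2 g -> ip (X f) g = ip f (X g)) /\
  (forall f, l2 f -> 0 <= ip f (X f)).

Definition is_pos_sqrt (R : realType) (d : nat) (D X : fop R d) : Prop :=
  [/\ bounded_op D, positive_op D & forall f, l2 f -> D (D f) = X f].

Definition shiftL (R : realType) (d : nat) (k : 'I_d) : fop R d :=
  fun h w => if w is i :: v then (if i == k then h v else 0) else 0.
Arguments shiftL : clear implicits.

(* L^w = L_{i_1} ... L_{i_m} for w = i_1 ... i_m *)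
Definition shiftLw (R : realType) (d : nat) (w : seq 'I_d) : fop R d :=
  fun h => foldr (fun k f => shiftL R d k f) h w.
Arguments shiftLw : clear implicits.

Definition Ut (R : realType) (d : nat) : fop R d := fun h w => h (rev w).

Definition fps_mul (R : realType) (d : nat) (g h : fps R d) : fps R d :=
  fun w => \sum_(i < (size w).+1) g (take i w) * h (drop i w).

Definition multL (R : realType) (d : nat) (g : fps R d) : fop R d := fps_mul g.
Definition multR (R : realType) (d : nat) (g : fps R d) : fop R d :=
  fun h => Ut (multL g (Ut h)).

(** ** NC functions on the row ball *)

Definition mxtup (R : realType) (d n : nat) : Type := 'I_d -> 'M[R[i]]_n.

Definition mxpow (R : realType) (d n : nat) (Z : mxtup R d n) (w : seq 'I_d) :
    'M[R[i]]_n :=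
  foldr (fun k M => Z k *m M) 1%:M w.

Definition posdef (R : realType) (n : nat) (M : 'M[R[i]]_n) : Prop :=
  forall v : 'cV[R[i]]_n, v != 0 -> 0 < (v^t* *m M *m v) 0 0.

Definition row_ball (R : realType) (d n : nat) (Z : mxtup R d n) : Prop :=
  posdef (1%:M - \sum_(j < d) Z j *m (Z j)^t*).

Definition opnorm_le (R : realType) (n : nat) (M : 'M[R[i]]_n) (c : R[i]) :
    Prop :=
  0 <= c /\ forall v : 'cV[R[i]]_n,
    \sum_(i < n) `|(M *m v) i 0| ^+ 2 <= c ^+ 2 * \sum_(i < n) `|v i 0| ^+ 2.

Definition graded_fun (R : realType) (d : nat) : Type :=
  forall n : nat, mxtup R d n -> 'M[R[i]]_n.

Definition nc_on_ball (R : realType) (d : nat) (F : graded_fun R d) : Prop :=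
  (forall n m (Z : mxtup R d n) (W : mxtup R d m), row_ball Z -> row_ball W ->
     F (n + m)%N (fun k => block_mx (Z k) 0 0 (W k))
     = block_mx (F n Z) 0 0 (F m W)) /\
  (forall n (Z : mxtup R d n) (S : 'M[R[i]]_n), S \in unitmx ->
     row_ball Z -> row_ball (fun k => invmx S *m Z k *m S) ->
     F n (fun k => invmx S *m Z k *m S) = invmx S *m F n Z *m S).

Definition ball_bound (R : realType) (d : nat) (F : graded_fun R d) (c : R[i]) :
    Prop :=
  forall n (Z : mxtup R d n), row_ball Z -> opnorm_le (F n Z) c.

(* An element of the free H^oo: a uniformly bounded NC function on the row
   ball, together with its Taylor coefficients at 0. The latter exist and are
   determined by the function; they are the symbol of the left multiplier with
   which the function is identified. Values outside the row ball are
   irrelevant. *)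
Record hinf (R : realType) (d : nat) := Hinf {
  hval : graded_fun R d;
  hcoef : fps R d;
  hval_nc : nc_on_ball hval;
  hval_bounded : exists c : R[i], ball_bound hval c;
  hval_taylor : forall n (Z : mxtup R d n), row_ball Z ->
    forall i j, word_psum (fun w => hcoef w * mxpow Z w i j) @ \oo
                --> (hval Z i j : R[i]^o)
}.

Definition hinf_ball1 (R : realType) (d : nat) (b : hinf R d) : Prop :=
  ball_bound (hval b) 1.

(** ** NC rational functions *)

Inductive ncexpr (R : realType) (d : nat) : Type :=
| NCvar of 'I_d
| NCconst of R[i]
| NCadd of ncexpr R d & ncexpr R d
| NCmul of ncexpr R d & ncexpr R d
| NCinv of ncexpr R d.

Fixpoint nceval (R : realType) (d n : nat) (s : ncexpr R d) (Z : mxtup R d n) :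
    'M[R[i]]_n :=
  match s with
  | NCvar k => Z k
  | NCconst a => a%:M
  | NCadd s1 s2 => nceval s1 Z + nceval s2 Z
  | NCmul s1 s2 => nceval s1 Z *m nceval s2 Z
  | NCinv s1 => invmx (nceval s1 Z)
  end.

Fixpoint ncdom (R : realType) (d n : nat) (s : ncexpr R d) (Z : mxtup R d n) :
    bool :=
  match s with
  | NCvar _ | NCconst _ => true
  | NCadd s1 s2 | NCmul s1 s2 => ncdom s1 Z && ncdom s2 Z
  | NCinv s1 => ncdom s1 Z && (nceval s1 Z \in unitmx)
  end.

(* Expressions that are nowhere defined represent no function (at size 0 every
   expression is trivially defined). *)
Definition nc_nondeg (R : realType) (d : nat) (s : ncexpr R d) : Prop :=
  exists n (Z : mxtup R d n), (0 < n)%N /\ ncdom s Z.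

Definition nc_equiv (R : realType) (d : nat) (s t : ncexpr R d) : Prop :=
  forall n (Z : mxtup R d n), ncdom s Z -> ncdom t Z -> nceval s Z = nceval t Z.

(* Z lies in the domain of the NC rational function represented by r, i.e. in
   the domain of some representative, and B is the value at Z. *)
Definition ncrat_value (R : realType) (d n : nat) (r : ncexpr R d)
    (Z : mxtup R d n) (B : 'M[R[i]]_n) : Prop :=
  exists s : ncexpr R d,
    [/\ nc_nondeg s, nc_equiv r s, ncdom s Z & nceval s Z = B].

Definition hinf_given_by (R : realType) (d : nat) (b : hinf R d)
    (r : ncexpr R d) : Prop :=
  nc_nondeg r /\
  forall n (Z : mxtup R d n), row_ball Z -> ncrat_value r Z (hval b Z).

(** ** The right free de Branges--Rovnyak space *)

Definition defect (R : realType) (d : nat) (b : hinf R d) : fop R d :=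
  fun h => h - multR (hcoef b) (adj (multR (hcoef b)) h).

(* In what follows D is the positive square root of [defect b]. *)
Definition dbr (R : realType) (d : nat) (D : fop R d) : set (fps R d) :=
  D @` @l2 R d.

(* The unique preimage of h under D in the orthogonal complement of ker D. *)
Definition dbr_lift (R : realType) (d : nat) (D : fop R d) (h : fps R d) :
    fps R d :=
  xget 0 [set f | [/\ l2 f, forall k, l2 k -> D k = 0 -> ip k f = 0 & D f = h]].

(* The inner product for which D is a co-isometry onto its range: D is
   isometric on the orthogonal complement of its kernel. *)
Definition dbr_ip (R : realType) (d : nat) (D : fop R d) (h g : fps R d) :
    R[i] :=
  ip (dbr_lift D h) (dbr_lift D g).

Definition lin_span (R : realType) (d : nat) (S : set (fps R d)) :
    set (fps R d) :=
  [set p | exists m (c : 'I_m -> R[i]) (s : 'I_m -> fps R d),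
     (forall i, S (s i)) /\ p = \sum_(i < m) c i *: s i].

Definition dbr_clspan (R : realType) (d : nat) (D : fop R d)
    (S : set (fps R d)) : set (fps R d) :=
  [set h | dbr D h /\ forall eps : R, 0 < eps ->
     exists2 p, lin_span S p & dbr_ip D (h - p) (h - p) < (eps%:C)%C].

Definition bt (R : realType) (d : nat) (b : hinf R d) : fps R d := Ut (hcoef b).

Definition dbr_M (R : realType) (d : nat) (D : fop R d) (b : hinf R d) :
    set (fps R d) :=
  [set h | exists (a : R[i]) (g : fps R d),
     dbr_clspan D
       [set f | exists2 w, w <> [::] & f = adj (shiftLw R d w) (bt b)] g /\
     h = a *: mono R d [::] + g].

(* The operator T(zeta)_k^*. *)
Definition Tadj (R : realType) (d : nat) (D : fop R d) (b : hinf R d)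
    (zeta : R[i]) (k : 'I_d) : fop R d :=
  fun h => adj (shiftL R d k) h +
           (zeta^* * dbr_ip D (mono R d [::]) h) *: adj (shiftL R d k) (bt b).

Definition subspace (R : realType) (d : nat) (K : set (fps R d)) : Prop :=
  K 0 /\ forall (a : R[i]) f g, K f -> K g -> K (a *: f + g).

Definition Tadj_invariant (R : realType) (d : nat) (D : fop R d) (b : hinf R d)
    (zeta : R[i]) (K : set (fps R d)) : Prop :=
  forall k h, K h -> K (Tadj D b zeta k h).

Definition Tadj_column_isometric (R : realType) (d : nat) (D : fop R d)
    (b : hinf R d) (zeta : R[i]) (K : set (fps R d)) : Prop :=
  forall h, K h ->
    \sum_(k < d) dbr_ip D (Tadj D b zeta k h) (Tadj D b zeta k h)
    = dbr_ip D h h.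

Definition is_onb (R : realType) (d n : nat) (D : fop R d) (K : set (fps R d))
    (e : 'I_n -> fps R d) : Prop :=
  [/\ forall j, K (e j),
      forall i j, dbr_ip D (e i) (e j) = (i == j)%:R
    & forall h, K h -> exists c : 'I_n -> R[i], h = \sum_(j < n) c j *: e j].

(* The matrices of the A_{zeta,k} in the basis e:
   <e_i, A_k e_j> = <A_k^* e_i, e_j> = <T(zeta)_k^* e_i, e_j>. *)
Definition Amx (R : realType) (d n : nat) (D : fop R d) (b : hinf R d)
    (zeta : R[i]) (e : 'I_n -> fps R d) : mxtup R d n :=
  fun k => \matrix_(i < n, j < n) dbr_ip D (Tadj D b zeta k (e i)) (e j).

(* Main.v *)
(* Let [C_k] be the matrices of the [T(zeta)_k^*] in the orthonormal basis
   [e_j] of [K] and [Z_k] their entrywise conjugates, so that [Z] is the tuple of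
   transposes at which [b] is evaluated. Since [1] is the evaluation vector at
   the origin, [e_j(kw) = sum_i C_k(i,j) e_i(w) - conj(zeta) e_j(0) b^t(kw)].
   Multiplying by the powers of [Z] and summing over words of length less
   than [m] yields, with [x = (e_j(0))_j], [S_m] the partial sums of [b(Z)] and
   [W_l] the sum of [Z^w (C^w)^T] over words of length [l],
     [sum_(l<m) sigma_l = sum_(l<m) (1 - conj(zeta) S_(m-l)) W_l x^T],
   where [sigma_l] tends to 0 because the [e_j] are square summable and the
   powers of [Z] of each length have constant total Frobenius norm. If
   [1 - conj(zeta) b(Z)] were invertible, the averages of [conj(x) W_l x^T], the
   total squared norm of the [x C^w] of length [l], would tend to 0; but the
   [x C^w] span all rows, and this observability keeps them away from 0.

   That [Z] lies in the domain of [b] comes from a Hankel realization of [b]: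
   its coefficients are [c X^w beta], where the entries of [X^w] are combinations
   of coefficients of [b], hence square summable. So the powers of
   [sum_k X_k (x) Z_k] tend to 0 and [1 - sum_k X_k (x) Z_k] is invertible. By
   Cayley-Hamilton its inverse at [Z] is polynomial in [Z]; multiplying the
   pencil by this polynomial matrix makes it the identity at [Z], so that
   Gaussian elimination without pivoting gives a rational expression defined
   at [Z]. It represents [b] because it has the same coefficients. *)
Require Import Defs.
From HB Require Import structures.
From mathcomp Require Import all_boot all_order all_algebra.
From mathcomp Require Import all_classical all_reals all_analysis.
From mathcomp Require Import complex mxtens.
From mathcomp Require Import ring lra zify.

Set Implicit Arguments.
Unset Strict Implicit.
Unset Printing Implicit Defensive.

Import Order.TTheory GRing.Theory Num.Theory.
Import numFieldNormedType.Exports.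
Local Open Scope ring_scope.

(** * Word sums and null sequences *)

Section WordSums.
Variable d : nat.
Implicit Types (m p q : nat) (w u v : seq 'I_d).

Definition wsum (V : nmodType) m (F : seq 'I_d -> V) : V :=
  \sum_(w : m.-tuple 'I_d) F w.

Lemma eq_wsum (V : nmodType) m (F G : seq 'I_d -> V) :
  (forall w, size w = m -> F w = G w) -> wsum m F = wsum m G.
Proof. by move=> FG; apply: eq_bigr => w _; rewrite FG ?size_tuple. Qed.

Lemma wsum0 (V : nmodType) (F : seq 'I_d -> V) : wsum 0 F = F [::].
Proof.
rewrite /wsum (big_pred1 [tuple]) //= => w.
by rewrite (tuple0 w); apply/esym/eqP.
Qed.

Lemma wsumS (V : nmodType) m (F : seq 'I_d -> V) :
  wsum m.+1 F = \sum_k wsum m (fun w => F (k :: w)).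
Proof.
rewrite /wsum pair_bigA /=.
rewrite (reindex (fun p : 'I_d * m.-tuple 'I_d => [tuple of p.1 :: p.2])) //=.
exists (fun t : m.+1.-tuple 'I_d => (thead t, [tuple of behead t])).
  by case=> k w _; congr pair; apply: val_inj.
by move=> t _; rewrite [RHS]tuple_eta; apply: val_inj.
Qed.

Lemma wsum_sum (V : nmodType) m (I : finType) (F : I -> seq 'I_d -> V) :
  wsum m (fun w => \sum_i F i w) = \sum_i wsum m (F i).
Proof. by rewrite /wsum exchange_big. Qed.

Lemma wsum_mulmxr (C : pzSemiRingType) n r s m (F : seq 'I_d -> 'M[C]_(n, r)) 
    (A : 'M[C]_(r, s)) :
  wsum m F *m A = wsum m (fun w => F w *m A).
Proof. by rewrite /wsum mulmx_suml. Qed.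

Lemma wsum_mulmxl (C : pzSemiRingType) n r s m (F : seq 'I_d -> 'M[C]_(r, s))
    (A : 'M[C]_(n, r)) :
  A *m wsum m F = wsum m (fun w => A *m F w).
Proof. by rewrite /wsum mulmx_sumr. Qed.

Lemma wsum_cat (V : nmodType) p q (F : seq 'I_d -> V) :
  wsum (p + q) F = wsum p (fun u => wsum q (fun v => F (u ++ v))).
Proof.
elim: p F => [|p IHp] F; first by rewrite wsum0.
by rewrite addSn !wsumS; apply: eq_bigr => k _; rewrite IHp.
Qed.

Lemma wsum_rcons (V : nmodType) m (F : seq 'I_d -> V) :
  wsum m.+1 F = \sum_k wsum m (fun w => F (rcons w k)).
Proof.
rewrite -addn1 wsum_cat -wsum_sum; apply: eq_wsum => w _.
by rewrite wsumS; apply: eq_bigr => k _; rewrite wsum0 cats1.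
Qed.

Lemma wsum_rev (V : nmodType) m (F : seq 'I_d -> V) :
  wsum m (fun w => F (rev w)) = wsum m F.
Proof.
elim: m F => [|m IHm] F; first by rewrite !wsum0.
rewrite wsumS wsum_rcons; apply: eq_bigr => k _.
by rewrite -[RHS]IHm; apply: eq_wsum => w _; rewrite rev_cons.
Qed.

Lemma ler_wsum (C : numDomainType) m (F G : seq 'I_d -> C) :
  (forall w, size w = m -> F w <= G w) -> wsum m F <= wsum m G.
Proof. by move=> FG; apply: ler_sum => w _; rewrite FG ?size_tuple. Qed.

Lemma wsum_ge0 (C : numDomainType) m (F : seq 'I_d -> C) :
  (forall w, 0 <= F w) -> 0 <= wsum m F.
Proof. by move=> F0; apply: sumr_ge0. Qed.

Lemma ler_norm_wsum (C : numDomainType) m (F : seq 'I_d -> C) :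
  `|wsum m F| <= wsum m (fun w => `|F w|).
Proof. exact: ler_norm_sum. Qed.

End WordSums.

(** * Null sequences over a numeric field *)

Section NullSequences.
Variable C : numFieldType.
Implicit Types u v : nat -> C.

(** Stated through the order alone, so that it makes sense over an abstract numeric field;
    [cvg_null_seq] links it to limits in [R[i]]. *)
Definition null_seq u :=
  forall e : C, 0 < e -> exists N, forall m, (N <= m)%N -> `|u m| <= e.

Lemma null_seq_le u v : (forall m, `|u m| <= v m) -> null_seq v -> null_seq u.
Proof.
move=> uv v0 e /v0[N vN]; exists N => m /vN; apply: le_trans.
by rewrite (le_trans (uv m)) // real_ler_norm // ger0_real // (le_trans _ (uv m)).
Qed.

Lemma eq_null_seq u v : u =1 v -> null_seq u -> null_seq v.
Proof. by move=> uv u0 e /u0[N uN]; exists N => m /uN; rewrite uv. Qed.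

Lemma null_seq0 : null_seq (fun=> 0).
Proof. by move=> e e0; exists 0 => m _; rewrite normr0 ltW. Qed.

Lemma null_seqD u v :
  null_seq u -> null_seq v -> null_seq (fun m => u m + v m).
Proof.
move=> u0 v0 e e0; have e2 : 0 < e / 2 by rewrite divr_gt0.
have [N uN] := u0 _ e2; have [M vM] := v0 _ e2.
exists (maxn N M) => m; rewrite geq_max => /andP[/uN um /vM vm].
by rewrite (le_trans (ler_normD _ _)) // [leRHS]splitr lerD.
Qed.

Lemma null_seqZ (c : C) u : null_seq u -> null_seq (fun m => c * u m).
Proof.
move=> u0 e e0; have c0 : 0 < `|c| + 1 by rewrite ltr_wpDl.
have [N uN] := u0 (e / (`|c| + 1)) (divr_gt0 e0 c0).
exists N => m /uN um; rewrite normrM.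
rewrite (@le_trans _ _ ((`|c| + 1) * `|u m|)) ?ler_wpM2r ?lerDl //.
by rewrite mulrC -ler_pdivlMr.
Qed.

Lemma null_seq_sum (I : finType) (u : I -> nat -> C) :
  (forall i, null_seq (u i)) -> null_seq (fun m => \sum_i u i m).
Proof.
move=> u0; elim: (index_enum I) => [|i r IHr].
  by apply: eq_null_seq null_seq0 => m; rewrite big_nil.
by apply: eq_null_seq (null_seqD (u0 i) IHr) => m; rewrite big_cons.
Qed.

Lemma null_seq_shift k u : null_seq u -> null_seq (fun m => u (m + k)%N).
Proof.
by move=> u0 e /u0[N uN]; exists N => m Nm; rewrite uN // (leq_trans Nm) ?leq_addr.
Qed.

Lemma null_seq_cst (c : C) u :
  null_seq u -> (forall m, `|c| <= u m) -> c = 0.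
Proof.
move=> u0 cu; apply/eqP; apply: contraT => c_neq0.
have c0 : 0 < `|c| / 2 by rewrite divr_gt0 ?normr_gt0.
have [N uN] := u0 _ c0.
have: `|c| <= `|c| / 2.
  apply: le_trans (uN N (leqnn N)); rewrite (le_trans (cu N)) // real_ler_norm //.
  by rewrite ger0_real // (le_trans _ (cu N)).
by rewrite {1}[`|c|]splitr gerDl => /(lt_le_trans c0); rewrite ltxx.
Qed.

(** An abstract numeric field need not be archimedean. This absorbs the fixed initial sum of a
    Cesaro mean into [e / 2 * m%:R]; [complex_arch] supplies it for [R[i]]. *)
Hypothesis arch : forall x : C, exists k : nat, `|x| <= k%:R.

Lemma cesaro_null u :
  null_seq u ->
  forall e : C, 0 < e ->
    exists N, forall m, (N <= m)%N -> `|\sum_(l < m) u l| <= e * m%:R.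
Proof.
move=> u0 e e0; have e2 : 0 < e / 2 by rewrite divr_gt0.
have [N uN] := u0 _ e2.
have [k kP] := arch ((\sum_(l < N) u l) / (e / 2)).
have {}kP : `|\sum_(l < N) u l| <= e / 2 * k%:R.
  by move: kP; rewrite normrM normfV (gtr0_norm e2) ler_pdivrMr // mulrC.
exists (maxn N k) => m; rewrite geq_max => /andP[Nm km].
rewrite -(subnKC Nm) big_split_ord /= subnKC //.
rewrite (le_trans (ler_normD _ _)) // [e]splitr mulrDl lerD //.
  apply: (le_trans kP); apply: ler_wpM2l; last by rewrite ler_nat.
  exact: ltW.
rewrite (le_trans (ler_norm_sum _ _ _)) //.
apply: (@le_trans _ _ (\sum_(i < m - N) e / 2)).
  by apply: ler_sum => i _; rewrite uN ?leq_addr.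
rewrite sumr_const card_ord -[_ *+ (m - N)]mulr_natr.
by apply: ler_wpM2l; rewrite ?ler_nat ?leq_subr // ltW.
Qed.

End NullSequences.

(** * Coefficient families whose squared mass on long words vanishes *)

Section LevelNull.
Variables (C : numFieldType) (d : nat).
Implicit Types f g : seq 'I_d -> C.

(** The form in which square summability enters the limit arguments. *)
Definition level_null f := null_seq (fun m => wsum m (fun w => `|f w| ^+ 2)).

Lemma level_null_le f g (c : C) :
  (forall w, `|f w| ^+ 2 <= c * `|g w| ^+ 2) -> level_null g -> level_null f.
Proof.
move=> fg g0; apply: null_seq_le (null_seqZ c g0) => m.
rewrite ger0_norm; last by apply: wsum_ge0 => w; apply: exprn_ge0.
by rewrite /wsum mulr_sumr; apply: ler_sum => w _; apply: fg.
Qed.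

Lemma eq_level_null f g : f =1 g -> level_null f -> level_null g.
Proof.
move=> fg; apply: eq_null_seq => m.
by apply: eq_wsum => w _; rewrite fg.
Qed.

Lemma sqr_normD_le (x y : C) :
  `|x + y| ^+ 2 <= 2 * (`|x| ^+ 2 + `|y| ^+ 2).
Proof.
have n0 := @normr_ge0 _ C; apply: (@le_trans _ _ ((`|x| + `|y|) ^+ 2)).
  by rewrite lerXn2r ?nnegrE ?addr_ge0 ?ler_normD.
rewrite -subr_ge0.
have -> : 2 * (`|x| ^+ 2 + `|y| ^+ 2) - (`|x| + `|y|) ^+ 2
          = (`|x| - `|y|) ^+ 2 by ring.
by apply: real_exprn_even_ge0 => //; rewrite rpredB ?normr_real.
Qed.

Lemma level_nullD f g :
  level_null f -> level_null g -> level_null (fun w => f w + g w).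
Proof.
move=> f0 g0; apply: null_seq_le (null_seqZ 2 (null_seqD f0 g0)) => m.
rewrite ger0_norm; last by apply: wsum_ge0 => w; apply: exprn_ge0.
rewrite /wsum -big_split mulr_sumr; apply: ler_sum => w _.
exact: sqr_normD_le.
Qed.

Lemma level_nullZ c f : level_null f -> level_null (fun w => c * f w).
Proof.
by apply: (level_null_le (c := `|c| ^+ 2)) => w; rewrite normrM exprMn.
Qed.

Lemma level_null_sum (I : finType) (F : I -> seq 'I_d -> C) :
  (forall i, level_null (F i)) -> level_null (fun w => \sum_i F i w).
Proof.
move=> F0; elim: (index_enum I) => [|i r IHr].
  apply: eq_null_seq (@null_seq0 C) => m; rewrite /wsum big1 // => w _.
  by rewrite big_nil normr0 expr0n.
by apply: eq_level_null (level_nullD (F0 i) IHr) => w; rewrite big_cons.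
Qed.

Lemma level_null_rev f : level_null f -> level_null (fun w => f (rev w)).
Proof.
apply: eq_null_seq => m.
by rewrite -(wsum_rev m (fun w => `|f w| ^+ 2)).
Qed.

(** Level [m] of the shifted family is a part of level [m.+1] of [f]. *)
Lemma level_null_cons f k : level_null f -> level_null (fun w => f (k :: w)).
Proof.
move=> f0; apply: null_seq_le (null_seq_shift 1 f0) => m.
have ge0 (F : seq 'I_d -> C) l : 0 <= wsum l (fun w => `|F w| ^+ 2).
  by apply: wsum_ge0 => w; rewrite exprn_ge0.
by rewrite ger0_norm // addn1 wsumS (bigD1 k) //= lerDl sumr_ge0.
Qed.

Lemma level_null_cat f u v :
  level_null f -> level_null (fun w => f (u ++ w ++ v)).
Proof.
have prefix g t : level_null g -> level_null (fun w => g (t ++ w)).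
  elim: t g => [|k t IHt] g g0 //=.
  exact: (IHt (fun w => g (k :: w))) (level_null_cons k g0).
(* Reversing words turns the suffix [v] into a prefix. *)
move=> /(prefix _ u)/level_null_rev/(prefix _ (rev v))/level_null_rev.
by apply: eq_level_null => w; rewrite rev_cat !revK.
Qed.

(** A weighted arithmetic-geometric inequality takes the place of Cauchy-Schwarz, which avoids
    square roots. *)
Lemma level_null_pairing f g (c : C) :
  level_null f -> (forall m, wsum m (fun w => `|g w| ^+ 2) <= c) ->
  null_seq (fun m => wsum m (fun w => f w * g w)).
Proof.
move=> f0 gc e e0.
have c0 : 0 <= c by rewrite (le_trans _ (gc 0)) ?wsum_ge0 // => w; rewrite exprn_ge0.
have c1 : 0 < c + 1 by rewrite ltr_wpDl.
(* This weight makes [t * c <= e / 2]; the levels of [f] are then taken below [t * (e / 2)]. The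
   denominator [c + 1] stays positive when [c = 0]. *)
pose t := e / 2 / (c + 1); have t0 : 0 < t by rewrite !divr_gt0.
have amgm (x y : C) : `|x * y| <= t^-1 * `|x| ^+ 2 + t * `|y| ^+ 2.
  rewrite normrM -(ler_pM2l t0) mulrDr mulVKf ?gt_eqF // -subr_ge0.
  have -> : `|x| ^+ 2 + t * (t * `|y| ^+ 2) - t * (`|x| * `|y|) =
     (`|x| - t * `|y|) ^+ 2 + t * (`|x| * `|y|) by ring.
  apply: addr_ge0; last exact: mulr_ge0 (ltW t0) (mulr_ge0 _ _).
  apply: real_exprn_even_ge0 => //.
  exact: realB (normr_real _) (realM (gtr0_real t0) (normr_real _)).
have [N fN] := f0 _ (mulr_gt0 t0 (divr_gt0 e0 (@ltr0n C 2))).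
exists N => m /fN.
rewrite ger0_norm => [fm|]; last by apply: wsum_ge0 => w; apply: exprn_ge0.
apply: (le_trans (ler_norm_wsum _ _)).
apply: (le_trans (ler_wsum (fun w _ => amgm (f w) (g w)))).
rewrite /wsum big_split -!mulr_sumr /= [leRHS]splitr lerD //.
  by rewrite mulrC ler_pdivrMr // mulrC.
apply: (@le_trans _ _ (t * c)); first by rewrite ler_wpM2l ?gc // ltW.
have ec : (c + 1)^-1 * c <= 1 by rewrite mulrC ler_pdivrMr // mul1r lerDl.
by rewrite /t -mulrA ler_piMr // ltW // divr_gt0.
Qed.

End LevelNull.

(** * Frobenius and entrywise matrix norms *)

Section MatrixNorms.
Variable C : numClosedFieldType.

(** The square of the Frobenius norm: no root is taken, so sums cost a factor 2 in [froD_le]. The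
    norm [norm1] is the one used where a triangle inequality and submultiplicativity are wanted. *)
Definition fro m n (M : 'M[C]_(m, n)) : C := \sum_i \sum_j `|M i j| ^+ 2.
Definition norm1 m n (M : 'M[C]_(m, n)) : C := \sum_i \sum_j `|M i j|.

Lemma fro_ge0 m n (M : 'M[C]_(m, n)) : 0 <= fro M.
Proof. by apply: sumr_ge0 => i _; apply: sumr_ge0 => j _; rewrite exprn_ge0. Qed.

Lemma norm1_ge0 m n (M : 'M[C]_(m, n)) : 0 <= norm1 M.
Proof. by apply: sumr_ge0 => i _; apply: sumr_ge0. Qed.

Lemma fro_row m n (M : 'M[C]_(m, n)) i : \sum_j `|M i j| ^+ 2 <= fro M.
Proof.
rewrite /fro [leRHS](bigD1 i) //= lerDl.
by apply: sumr_ge0 => *; apply: sumr_ge0 => *; rewrite exprn_ge0.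
Qed.

Lemma fro_entry m n (M : 'M[C]_(m, n)) i j : `|M i j| ^+ 2 <= fro M.
Proof.
apply: le_trans (fro_row M i); rewrite (bigD1 j) //= lerDl.
by apply: sumr_ge0 => *; rewrite exprn_ge0.
Qed.

Lemma fro_scalar1 n : fro (1%:M : 'M[C]_n) = n%:R.
Proof.
rewrite /fro (eq_bigr (fun=> 1)) => [|i _]; last first.
  rewrite (bigD1 i) //= mxE eqxx normr1 expr1n big1 ?addr0 // => j ji.
  by rewrite mxE eq_sym (negbTE ji) normr0 expr0n.
by rewrite sumr_const card_ord.
Qed.

Lemma fro0 m n : fro (0 : 'M[C]_(m, n)) = 0.
Proof.
rewrite /fro big1 // => i _; rewrite big1 // => j _.
by rewrite mxE normr0 expr0n.
Qed.

Lemma froD_le m n (M N : 'M[C]_(m, n)) : fro (M + N) <= 2 * (fro M + fro N).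
Proof.
rewrite /fro -big_split mulr_sumr; apply: ler_sum => i _ /=.
rewrite -big_split mulr_sumr; apply: ler_sum => j _ /=.
by rewrite mxE sqr_normD_le.
Qed.

Lemma fro_sum_le (I : Type) (r : seq I) m n (M : I -> 'M[C]_(m, n)) :
  fro (\sum_(i <- r) M i) <= 2 ^+ size r * \sum_(i <- r) fro (M i).
Proof.
elim: r => [|i r IHr]; first by rewrite !big_nil fro0 mulr0.
rewrite !big_cons /= exprS -mulrA (le_trans (froD_le _ _)) //.
rewrite ler_pM2l // mulrDr lerD // ler_peMl ?fro_ge0 //.
by rewrite exprn_ege1 // ler1n.
Qed.

Lemma fro_mulmx_col m n (a : 'cV[C]_m) (y : 'rV[C]_n) :
  fro (a *m y) = fro a * fro y.
Proof.
rewrite /fro mulr_suml; apply: eq_bigr => i _; rewrite !big_ord1 mulr_sumr.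
by apply: eq_bigr => j _; rewrite mxE big_ord1 normrM exprMn.
Qed.

Lemma norm1_entry m n (M : 'M[C]_(m, n)) i j : `|M i j| <= norm1 M.
Proof.
rewrite /norm1 (bigD1 i) //= (bigD1 j) //= -addrA lerDl addr_ge0 ?sumr_ge0 //.
by move=> *; apply: sumr_ge0.
Qed.

Lemma norm1D m n (M N : 'M[C]_(m, n)) : norm1 (M + N) <= norm1 M + norm1 N.
Proof.
rewrite /norm1 -big_split; apply: ler_sum => i _ /=.
by rewrite -big_split; apply: ler_sum => j _ /=; rewrite mxE ler_normD.
Qed.

Lemma norm1_sum (I : Type) (r : seq I) m n (M : I -> 'M[C]_(m, n)) :
  norm1 (\sum_(i <- r) M i) <= \sum_(i <- r) norm1 (M i).
Proof.
elim: r => [|i r IHr].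
  rewrite !big_nil /norm1 big1 // => i _; rewrite big1 // => j _.
  by rewrite mxE normr0.
by rewrite !big_cons (le_trans (norm1D _ _)) // lerD2l.
Qed.

Lemma norm1M m n p (M : 'M[C]_(m, n)) (N : 'M[C]_(n, p)) :
  norm1 (M *m N) <= norm1 M * norm1 N.
Proof.
rewrite /norm1 mulr_suml; apply: ler_sum => i _.
rewrite mulr_suml [leRHS](_ : _ = \sum_j \sum_k \sum_l `|M i j| * `|N k l|);
  last by apply: eq_bigr => j _; rewrite mulr_sumr; apply: eq_bigr => k _;
          rewrite mulr_sumr.
apply: (@le_trans _ _ (\sum_j \sum_l `|M i j| * `|N j l|)).
  rewrite exchange_big /=; apply: ler_sum => l _; rewrite mxE.
  by rewrite (le_trans (ler_norm_sum _ _ _)) // ler_sum // => j _; rewrite normrM.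
apply: ler_sum => j _; rewrite [leRHS](bigD1 j) //= lerDl.
by apply: sumr_ge0 => k _; apply: sumr_ge0 => l _; rewrite mulr_ge0.
Qed.

Lemma null_norm1 m n (M : nat -> 'M[C]_(m, n)) :
  (forall i j, null_seq (fun l => M l i j)) -> null_seq (fun l => norm1 (M l)).
Proof.
move=> M0; apply: null_seq_sum => i; apply: null_seq_sum => j e /(M0 i j)[N MN].
by exists N => l /MN; rewrite normr_id.
Qed.

End MatrixNorms.

(** * Powers of matrix tuples and the averaging argument *)

Section WordPowers.
Variables (C : numClosedFieldType) (d n : nat).
Implicit Types (Z A : 'I_d -> 'M[C]_n) (u v w : seq 'I_d).

Definition wordmx Z w : 'M[C]_n := foldr (fun k M => Z k *m M) 1%:M w.

Lemma wordmx_cat Z u v : wordmx Z (u ++ v) = wordmx Z u *m wordmx Z v.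
Proof. by elim: u => [|k u IHu] /=; rewrite ?mul1mx // IHu mulmxA. Qed.

Lemma wordmx_rcons Z w k : wordmx Z (rcons w k) = wordmx Z w *m Z k.
Proof. by rewrite -cats1 wordmx_cat /= mulmx1. Qed.

(** For [A] the matrices of the [T(zeta)_k^*], this is the tuple of transposes at which [b] is
    evaluated; see [Amx_tr_compression]. *)
Definition conj_tup A := fun k => map_mx Num.conj (A k).

Lemma wordmx_conj A w : wordmx (conj_tup A) w = map_mx Num.conj (wordmx A w).
Proof. by elim: w => [|k w IHw] /=; rewrite ?map_mx1 // IHw map_mxM. Qed.

(** The trace of the column-isometry relation iterated along words: the products of the adjoint of
    [wordmx A w] with [wordmx A w], over words of length [m], sum to the identity, of trace [n]. *)
Definition word_isometric A :=
  forall m, wsum m (fun w => fro (wordmx A w)) = n%:R.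

Lemma wsum_wordmx_entry A i j m :
  word_isometric A -> wsum m (fun w => `|wordmx A w i j| ^+ 2) <= n%:R.
Proof. by move=> isoA; rewrite -(isoA m); apply: ler_wsum => w _; apply: fro_entry. Qed.

Lemma wsum_conj_wordmx_entry A i j m :
  word_isometric A ->
  wsum m (fun w => `|wordmx (conj_tup A) w i j| ^+ 2) <= n%:R.
Proof.
move=> isoA; apply: le_trans (wsum_wordmx_entry i j m isoA).
by apply: ler_wsum => w _; rewrite wordmx_conj mxE norm_conjC.
Qed.

End WordPowers.

(** * Quantitative observability *)

Section Observability.
Variables (C : numClosedFieldType) (d n : nat) (A : 'I_d -> 'M[C]_n) (x : 'rV[C]_n).
Hypothesis obs :
  forall y : 'cV[C]_n, (forall w, x *m wordmx A w *m y = 0) -> y = 0.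

(** Words of length less than [L] form a finite type, so that [V L] is a finite sum of row
    spaces. *)
Let words L : finType := {q : 'I_L & q.-tuple 'I_d}.
Let word L (s : words L) : seq 'I_d := tagged s.
Let V L := (\sum_(s : words L) <<x *m wordmx A (word s)>>)%MS.

Let V_sup w L : (size w < L)%N -> (x *m wordmx A w <= V L)%MS.
Proof.
move=> wL; pose s : words L :=
  @Tagged _ (Ordinal wL) (fun q : 'I_L => q.-tuple 'I_d) (in_tuple w).
apply: submx_trans (_ : (<<x *m wordmx A (word s)>> <= _)%MS).
  by rewrite genmxE.
exact: (sumsmx_sup s).
Qed.

Let V_mono L M : (L <= M)%N -> (V L <= V M)%MS.
Proof.
move=> LM; apply/sumsmx_subP => s _; rewrite genmxE; apply: V_sup.
by rewrite size_tuple (leq_trans (ltn_ord _)).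
Qed.

(** The ranks of the [V L] are bounded by [n]. One of maximal rank contains every [x *m wordmx A w],
    and [obs] then leaves no room for a cokernel. *)
Let V_full : exists L, (1%:M <= V L)%MS.
Proof.
have exV : exists r, `[< exists L, \rank (V L) = r >].
  by exists (\rank (V 0)); apply/asboolP; exists 0.
have ubV r : `[< exists L, \rank (V L) = r >] -> (r <= n)%N.
  by move=> /asboolP[L <-]; rewrite rank_leq_col.
case: (ex_maxnP exV ubV) => r /asboolP[L VLr] maxr; exists L.
rewrite sub1mx.
have VL w : (x *m wordmx A w <= V L)%MS.
  have LM : (L <= maxn L (size w).+1)%N by rewrite leq_maxl.
  apply: submx_trans (V_sup (leq_maxr L (size w).+1)) _.
  rewrite -(geq_leqif (mxrank_leqif_sup (V_mono LM))) VLr maxr //.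
  by apply/asboolP; eexists.
(* Each column of the cokernel is annihilated by all rows [x *m wordmx A w]. *)
have : cokermx (V L) = 0.
  apply/matrixP => i j; rewrite mxE; have := @obs (col j (cokermx (V L))).
  move=> /(_ _)/colP/(_ i); rewrite !mxE; apply => w.
  by rewrite colE mulmxA (_ : _ *m cokermx _ = 0) ?mul0mx //; apply/eqP; rewrite -submxE.
move=> /eqP; rewrite -mxrank_eq0 mxrank_coker subn_eq0 => nV.
by rewrite /row_full eqn_leq rank_leq_col.
Qed.

(** Write the identity as a finite combination of columns [a s] times rows [x *m wordmx A w] and
    multiply by [Y]: the constant depends only on the number of words and on the [a s], not on
    [Y]. *)
Lemma observability_bound :
  exists2 c : C, 0 <= c & exists L, forall p (Y : 'M[C]_(n, p)),
    fro Y <= c * \sum_(q < L) wsum q (fun w => fro (x *m wordmx A w *m Y)).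
Proof.
have [L /sub_sumsmxP[U Udef]] := V_full.
have /choice[a aP] (s : words L) : exists a : 'cV[C]_n,
    U s *m <<x *m wordmx A (word s)>>%MS = a *m (x *m wordmx A (word s)).
  apply/submxP; rewrite (submx_trans (submxMl _ _)) //.
  by rewrite genmxE.
exists (2 ^+ #|words L| * \sum_s fro (a s)).
  by rewrite mulr_ge0 ?exprn_ge0 ?sumr_ge0 // => s _; rewrite fro_ge0.
exists L => p Y.
rewrite -[Y in fro Y]mul1mx Udef mulmx_suml.
rewrite (eq_bigr (fun s => a s *m (x *m wordmx A (word s) *m Y))); last first.
  by move=> s _; rewrite aP !mulmxA.
apply: le_trans (fro_sum_le _ _) _.
have -> : size (index_enum (words L)) = #|words L| by rewrite cardT enumT.
rewrite -mulrA ler_pM2l ?exprn_gt0 // mulr_suml; apply: ler_sum => s _.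
rewrite fro_mulmx_col ler_wpM2l ?fro_ge0 //.
rewrite /wsum (sig_big_dep _ _ (fun (q : 'I_L) (w : q.-tuple 'I_d) =>
  fro (x *m wordmx A w *m Y))) /=.
rewrite (bigD1 s) //= lerDl.
by apply: sumr_ge0 => t _; rewrite fro_ge0.
Qed.

End Observability.

(** * The telescoping identity and the singularity of [1 - c B] *)

Section Singularity.
Variables (C : numClosedFieldType) (d n : nat).
Hypothesis arch : forall x : C, exists k : nat, `|x| <= k%:R.
(** [A] stands for the matrices of the [T(zeta)_k^*], [E] for the orthonormal basis of [K], [g] for
    [b^t], [c] for the conjugate of [zeta] and [B] for the value of [b]. *)
Variables (A : 'I_d -> 'M[C]_n) (E : 'I_n -> seq 'I_d -> C).
Variables (g : seq 'I_d -> C) (c : C) (B : 'M[C]_n).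
Hypothesis n_gt0 : (0 < n)%N.
Hypothesis isoA : word_isometric A.
Hypothesis g0 : g [::] = 0.
Hypothesis E_cons : forall j k w,
  E j (k :: w) = \sum_i A k i j * E i w - c * E j [::] * g (k :: w).
Hypothesis E_null : forall j, level_null (E j).
Hypothesis E_free : forall y : 'cV[C]_n,
  (forall w, \sum_j E j w * y j 0 = 0) -> y = 0.

Let Z := conj_tup A.
Let x : 'rV[C]_n := \row_j E j [::].
(** Words are reversed because [g] is to be [b^t]: [psum g m] is then a partial sum of [b] at
    [Z]. *)
Let level f l : 'M[C]_n := wsum l (fun w => f w *: wordmx Z (rev w)).
Let psum f m := \sum_(l < m) level f l.

Hypothesis B_lim : forall i j, null_seq (fun m => (B - psum g m) i j).

Let xE (v : 'cV[C]_n) : (x *m v) 0 0 = \sum_j E j [::] * v j 0.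
Proof. by rewrite mxE; apply: eq_bigr => j _; rewrite mxE. Qed.

(** By [E_cons], the combination of the [E j] with coefficients [y] takes at [k :: w] the value at
    [w] of the combination with coefficients [A k *m y], up to a multiple of [x *m y]. Since
    [A k *m y] is annihilated as well, all values vanish and [E_free] applies. *)
Let x_obs (y : 'cV[C]_n) : (forall w, x *m wordmx A w *m y = 0) -> y = 0.
Proof.
move=> xy; apply: E_free => w; elim: w y xy => [|k w IHw] y xy.
  by rewrite -xE -[x]mulmx1 [x *m _ *m y](xy [::]) mxE.
have xy0 : \sum_j E j [::] * y j 0 = 0.
  by rewrite -xE -[x]mulmx1 [x *m _ *m y](xy [::]) mxE.
rewrite -[RHS](IHw (A k *m y)) => [|v]; last first.
  by rewrite -[RHS](xy (rcons v k)) wordmx_rcons !mulmxA.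
transitivity (\sum_j \sum_i A k i j * E i w * y j 0
              - c * g (k :: w) * \sum_j E j [::] * y j 0).
  rewrite mulr_sumr -sumrB; apply: eq_bigr => j _.
  by rewrite E_cons mulrBl mulr_suml; ring.
rewrite xy0 mulr0 subr0 exchange_big /=; apply: eq_bigr => i _.
by rewrite mxE mulr_sumr; apply: eq_bigr => j _; ring.
Qed.

Let W l : 'M[C]_n := wsum l (fun w => wordmx Z w *m (wordmx A w)^T).

Let W_S l : W l.+1 = \sum_k Z k *m W l *m (A k)^T.
Proof.
rewrite /W wsumS; apply: eq_bigr => k _.
rewrite wsum_mulmxl wsum_mulmxr; apply: eq_wsum => w _ /=.
by rewrite trmx_mul !mulmxA.
Qed.

Let sigma l (M : 'M[C]_n) : 'cV[C]_n := \sum_j level (E j) l *m col j M.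

Let sigma0 M : sigma 0 M = M *m x^T.
Proof.
apply/colP => i; rewrite /sigma summxE mxE; apply: eq_bigr => j _.
by rewrite /level wsum0 /= -scalemxAl mul1mx !mxE mulrC.
Qed.

Let level_cons f l :
  level f l.+1 = \sum_k level (fun w => f (k :: w)) l *m Z k.
Proof.
rewrite /level wsumS; apply: eq_bigr => k _; rewrite wsum_mulmxr.
by apply: eq_wsum => w _; rewrite rev_cons wordmx_rcons scalemxAl.
Qed.

Let levelE j l :
  level (E j) l.+1 = \sum_k \sum_i A k i j *: (level (E i) l *m Z k)
                     - (c * E j [::]) *: level g l.+1.
Proof.
rewrite !level_cons scaler_sumr -sumrB; apply: eq_bigr => k _.
transitivity ((\sum_i A k i j *: level (E i) l
   - (c * E j [::]) *: level (fun w => g (k :: w)) l) *m Z k); last first.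
  rewrite mulmxBl -scalemxAl mulmx_suml; congr (_ - _).
  by apply: eq_bigr => i _; rewrite scalemxAl.
congr (_ *m _); rewrite /level /wsum scaler_sumr.
rewrite [X in X - _](_ : _ = \sum_(w : l.-tuple 'I_d)
    \sum_i (A k i j * E i w) *: wordmx Z (rev w)); last first.
  rewrite exchange_big /=; apply: eq_bigr => i _; rewrite scaler_sumr.
  by apply: eq_bigr => w _; rewrite scalerA.
rewrite -sumrB; apply: eq_bigr => w _.
by rewrite E_cons scalerBl scaler_suml scalerA.
Qed.

(** [E_cons] removes one letter from the words in [level (E j)]; the freed factors [Z k] and [A k]
    are absorbed by [W] through [W_S]. The [g] term of [E_cons] is what remains. *)
Let sigma_S l p :
  sigma l.+1 (W p) = sigma l (W p.+1) - c *: (level g l.+1 *m (W p *m x^T)).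
Proof.
have -> : level g l.+1 *m (W p *m x^T) =
    \sum_j E j [::] *: (level g l.+1 *m col j (W p)).
  have -> : W p *m x^T = \sum_j E j [::] *: col j (W p).
    apply/colP => i; rewrite summxE mxE; apply: eq_bigr => j _.
    by rewrite !mxE mulrC.
  by rewrite mulmx_sumr; apply: eq_bigr => j _; rewrite scalemxAr.
rewrite /sigma scaler_sumr.
rewrite (eq_bigr (fun j => (\sum_k \sum_i A k i j *: (level (E i) l *m Z k))
    *m col j (W p) - c *: (E j [::] *: (level g l.+1 *m col j (W p)))));
  last by move=> j _; rewrite levelE mulmxBl -scalemxAl scalerA.
rewrite sumrB; congr (_ - _).
transitivity (\sum_i \sum_j \sum_k
    level (E i) l *m (A k i j *: (Z k *m col j (W p)))).
  rewrite exchange_big /=; apply: eq_bigr => j _; rewrite mulmx_suml.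
  rewrite exchange_big /=; apply: eq_bigr => k _; rewrite mulmx_suml.
  by apply: eq_bigr => i _; rewrite -scalemxAl -scalemxAr mulmxA.
apply: eq_bigr => i _; rewrite exchange_big /= W_S.
rewrite [col i _]raddf_sum mulmx_sumr; apply: eq_bigr => k _.
rewrite -mulmx_sumr; congr (_ *m _); apply/colP => a; rewrite summxE !mxE.
apply: eq_bigr => j _; rewrite !mxE mulrC; congr (_ * _).
by apply: eq_bigr => b _; rewrite [col j _ _ _]mxE.
Qed.

Let Q m : 'M[C]_n := 1%:M - c *: psum g m.

(** Induction on [m] with [p] free: each use of [sigma_S] moves one level from [E] to [W], and the
    leftover [g] terms attached to the same [W] add up to [Q]. *)
Let telescope m p :
  \sum_(l < m) sigma l (W p) = \sum_(l < m) Q (m - l) *m (W (l + p) *m x^T).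
Proof.
elim: m p => [|m IHm] p; first by rewrite !big_ord0.
rewrite !big_ord_recl /= subn0 add0n sigma0.
have -> : \sum_(l < m) sigma (bump 0 l) (W p) = \sum_(l < m) sigma l (W p.+1)
    - c *: (\sum_(l < m) level g l.+1 *m (W p *m x^T)).
  by rewrite scaler_sumr -sumrB; apply: eq_bigr => l _; rewrite sigma_S.
rewrite IHm addrCA [RHS]addrC; congr (_ + _).
  by apply: eq_bigr => l _; rewrite /bump /= add1n subSS addnS.
rewrite /Q mulmxBl mul1mx -scalemxAl; congr (_ - c *: _).
(* Since [g [::] = 0], the levels from 1 to [m] already make up [psum g m.+1]. *)
rewrite /psum big_ord_recl [level g _]wsum0 g0 scale0r add0r.
by rewrite [RHS]mulmx_suml.
Qed.

Let a l : C := wsum l (fun w => fro (x *m wordmx A w)).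

Let aE l : a l = (map_mx Num.conj x *m (W l *m x^T)) 0 0.
Proof.
rewrite mulmxA wsum_mulmxl wsum_mulmxr summxE; apply: eq_bigr => w _.
rewrite mulmxA -mulmxA -trmx_mul wordmx_conj -map_mxM mxE /fro big_ord1.
by apply: eq_bigr => j _; rewrite !mxE normCK mulrC.
Qed.

Let a_ge0 l : 0 <= a l.
Proof. by apply: wsum_ge0 => w; apply: fro_ge0. Qed.

(** The crude bound [u * v <= u ^+ 2 + v ^+ 2] estimates each entry by two Frobenius masses, each
    equal to [n] by [isoA]; what matters is uniformity in [l]. *)
Let norm1_W l : norm1 (W l) <= \sum_(i < n) \sum_(j < n) (n%:R + n%:R).
Proof.
apply: ler_sum => i _; apply: ler_sum => j _; rewrite summxE.
apply: (le_trans (ler_norm_sum _ _ _)).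
rewrite -(isoA l) -big_split.
apply: ler_sum => w _ /=; rewrite mxE.
rewrite (le_trans (ler_norm_sum _ _ _)) //.
rewrite (le_trans _ (lerD (fro_row _ i) (fro_row _ j))) // -big_split.
apply: ler_sum => k _ /=; rewrite wordmx_conj !mxE normrM norm_conjC.
have ab : (0 : C) <= `|wordmx A w i k| * `|wordmx A w j k| by rewrite mulr_ge0.
rewrite -subr_ge0; set u := `|_|; set v := `|_|.
have -> : u ^+ 2 + v ^+ 2 - u * v = (u - v) ^+ 2 + u * v by ring.
rewrite addr_ge0 // real_exprn_even_ge0 //.
exact: realB (normr_real _) (normr_real _).
Qed.

Let null_level j i k : null_seq (fun l => level (E j) l i k).
Proof.
have := level_null_pairing (E_null j) (c := n%:R)
  (g := fun w => wordmx Z (rev w) i k).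
move=> null; apply: eq_null_seq (null _) => [l|l].
  by rewrite /level summxE; apply: eq_bigr => w _; rewrite mxE.
rewrite (wsum_rev l (fun w => `|wordmx Z w i k| ^+ 2)).
exact: wsum_conj_wordmx_entry.
Qed.

Let null_sigma : null_seq (fun l => norm1 (sigma l (W 0))).
Proof.
apply: null_norm1 => i j.
have : null_seq (fun l => \sum_k \sum_b W 0 b k * level (E k) l i b).
  by apply: null_seq_sum => k; apply: null_seq_sum => b; apply: null_seqZ.
apply: eq_null_seq => l; rewrite summxE; apply: eq_bigr => k _.
by rewrite mxE; apply: eq_bigr => b _; rewrite !mxE mulrC.
Qed.

(** Observability with [Y = wordmx A w], summed over words of length [l], bounds [n] by a multiple
    of the sum of [a] over the window from [l] to [l + L - 1]. Summing over [l < m] counts each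
    index at most [L] times, whence the factor [L%:R]. *)
Let a_unbounded : exists2 k : C, 0 <= k & exists L, forall m,
  n%:R * m%:R <= k * \sum_(l < m + L) a l.
Proof.
have [k k0 [L kL]] := observability_bound x_obs.
exists (k * L%:R); first by rewrite mulr_ge0.
exists L => m.
have nk l : n%:R <= k * \sum_(q < L) a (l + q).
  rewrite -(isoA l).
  apply: le_trans (ler_wsum (fun w _ => kL _ _)) _.
  rewrite /wsum -mulr_sumr ler_wpM2l // exchange_big /=.
  apply: ler_sum => q _; rewrite addnC /a wsum_cat /wsum exchange_big /=.
  apply: ler_sum => v _; apply: ler_sum => w _.
  by rewrite wordmx_cat mulmxA.
rewrite mulr_natr -[m in n%:R *+ m]card_ord -sumr_const.
apply: (@le_trans _ _ (\sum_(l < m) k * \sum_(q < L) a (l + q))).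
  by apply: ler_sum => l _; apply: nk.
rewrite -mulr_sumr -mulrA ler_wpM2l // exchange_big /=.
rewrite mulr_natl -[L in _ *+ L]card_ord -sumr_const.
apply: ler_sum => q _.
rewrite (eq_bigr (fun l : 'I_m => a (q + l))) => [|l _]; last by rewrite addnC.
have qL : (q + m <= m + L)%N by rewrite addnC leq_add2l ltnW.
rewrite -(subnKC qL) !big_split_ord /= addrAC lerDr.
by rewrite addr_ge0 // sumr_ge0.
Qed.

(** Insert [invmx QB *m QB] into [aE] and replace [QB] by [Q (m - l)], to which [telescope] applies.
    The two terms of [u] bound the resulting [sigma] and the error of this replacement. *)
Let a_sum_le : 1%:M - c *: B \in unitmx ->
  exists u, null_seq u /\ forall m, \sum_(l < m) a l <= `|\sum_(l < m) u l|.
Proof.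
set QB := 1%:M - c *: B => uQ.
pose k : C := \sum_(i < n) \sum_(j < n) (n%:R + n%:R).
pose t := norm1 (map_mx Num.conj x *m invmx QB).
pose u l := t * (norm1 (sigma l (W 0)) + norm1 (QB - Q l.+1) * (k * norm1 x^T)).
exists u; split.
  apply: null_seqZ; apply: null_seqD null_sigma _.
  apply: (@eq_null_seq _ (fun l => (k * norm1 x^T) * norm1 (QB - Q l.+1))).
    by move=> l; rewrite mulrC.
  apply: null_seqZ; apply: null_norm1 => i j.
  have := null_seqZ (- c) (null_seq_shift 1 (B_lim i j)).
  apply: eq_null_seq => l; rewrite addn1 /QB /Q !mxE; ring.
move=> m; have u0 l : 0 <= u l.
  rewrite !(mulr_ge0, addr_ge0) ?norm1_ge0 //.
  by apply: sumr_ge0 => i _; apply: sumr_ge0 => j _; rewrite addr_ge0.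
rewrite ger0_norm ?sumr_ge0 // -mulr_sumr.
rewrite -[leLHS]ger0_norm ?sumr_ge0 //.
have -> : \sum_(l < m) a l = (map_mx Num.conj x *m invmx QB *m
   (QB *m \sum_(l < m) (W l *m x^T))) 0 0.
  rewrite mulmxA mulmxKV // mulmx_sumr summxE.
  by apply: eq_bigr => l _; apply: aE.
apply: (le_trans (norm1_entry _ _ _)); apply: (le_trans (norm1M _ _)).
rewrite ler_wpM2l ?norm1_ge0 //.
have -> : QB *m (\sum_(l < m) W l *m x^T) = \sum_(l < m) sigma l (W 0)
    + \sum_(l < m) (QB - Q (m - l)) *m (W l *m x^T).
  rewrite telescope -big_split mulmx_sumr; apply: eq_bigr => l _ /=.
  by rewrite addn0 -mulmxDl [_ + (QB - _)]addrC subrK.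
rewrite big_split /= (le_trans (norm1D _ _)) // lerD ?norm1_sum //.
apply: (le_trans (norm1_sum _ _)).
(* Reversing the summation matches [Q (m - l)] with the [Q l.+1] in [u]. *)
rewrite [leRHS](reindex_inj rev_ord_inj) /=; apply: ler_sum => l _.
rewrite subnSK // (le_trans (norm1M _ _)) // ler_wpM2l ?norm1_ge0 //.
by rewrite (le_trans (norm1M _ _)) // ler_wpM2r ?norm1_ge0 ?norm1_W.
Qed.

(* If [1 - c B] were invertible, the telescoped identity would make the
   averages of [a] tend to 0, while observability bounds them from below. *)
Lemma singular_at_word_isometric : 1%:M - c *: B \notin unitmx.
Proof.
apply/negP => /a_sum_le[u [u0 au]]; have [k k0 [L aL]] := a_unbounded.
(* This gives [k * e <= 1 / 4]. For [m >= L] the upper bound [k * e * (m + L)] is at most [m / 2],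
   which is below [n * m] because the successor in [m] makes it positive. *)
pose e : C := (4 * (k + 1))^-1.
have k1 : 0 < 4 * (k + 1) by rewrite mulr_gt0 // ltr_wpDl.
have e0 : 0 < e by rewrite invr_gt0.
have [N uN] := cesaro_null arch u0 e0.
pose m := (maxn N L).+1.
have mN : (N <= m + L)%N by rewrite (leq_trans (leq_maxl N L)) // ltnW // ltnS leq_addr.
have mL : (L <= m)%N by rewrite (leq_trans (leq_maxr N L)).
have := le_trans (aL m) (ler_wpM2l k0 (le_trans (au _) (uN _ mN))).
have ke : k * e <= 4^-1.
  rewrite /e invfM mulrCA ler_piMr ?invr_ge0 //.
  by rewrite ler_pdivrMr ?ltr_wpDl // mul1r lerDl.
have mL2 : ((m + L)%:R : C) <= (m * 2)%:R.
  by rewrite ler_nat muln2 -addnn leq_add2l.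
have ke0 : 0 <= k * e := mulr_ge0 k0 (ltW e0).
have mlt : k * (e * (m + L)%:R) < n%:R * m%:R.
  rewrite mulrA (le_lt_trans (ler_pM ke0 (ler0n _ _) ke mL2)) //.
  rewrite mulrC ltr_pdivrMr // -!natrM ltr_nat.
  by rewrite (@leq_trans (m * 4)) ?ltn_pmul2l // leq_mul // leq_pmull.
by move=> /(lt_le_trans mlt); rewrite ltxx.
Qed.

End Singularity.

(** * Hankel matrices and linear pencils *)

Section Hankel.
Variables (C : numClosedFieldType) (d : nat) (h : seq 'I_d -> C).
Implicit Types (u v w : seq 'I_d).

Definition realizes_coef N (X : 'I_d -> 'M[C]_N) (c : 'rV[C]_N)
    (b : 'cV[C]_N) :=
  forall w, (c *m wordmx X w *m b) 0 0 = h w.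

Definition hankel p (us vs : 'I_p -> seq 'I_d) w : 'M[C]_p :=
  \matrix_(i, j) h (us i ++ w ++ vs j).

Let hrow p (vs : 'I_p -> seq 'I_d) u : 'rV[C]_p := \row_j h (u ++ vs j).
Let hcol p (us : 'I_p -> seq 'I_d) v : 'cV[C]_p := \col_i h (us i ++ v).

Let extend p (us : 'I_p -> seq 'I_d) u (i : 'I_(p + 1)) :=
  if fintype.split i is inl i' then us i' else u.

Let hankel_extend p (us vs : 'I_p -> seq 'I_d) u v :
  hankel (extend us u) (extend vs v) [::] =
  block_mx (hankel us vs [::]) (hcol us v) (hrow vs u) (h (u ++ v))%:M.
Proof.
apply/matrixP => i j; rewrite !mxE /extend.
by case: (fintype.split i) => i'; rewrite !mxE;
  case: (fintype.split j) => j'; rewrite !mxE // ?ord1 ?eqxx.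
Qed.

(** Block elimination: the second factor is the Schur complement of [G]. *)
Let det_bordered p (G : 'M[C]_p) (r : 'rV_p) (s : 'cV_p) (a : C) :
  G \in unitmx ->
  \det (block_mx G s r a%:M) = \det G * (a - (r *m invmx G *m s) 0 0).
Proof.
move=> uG; have -> : block_mx G s r a%:M =
    block_mx 1%:M 0 (r *m invmx G) 1%:M *m
    block_mx G s 0 (a%:M - r *m invmx G *m s).
  rewrite mulmx_block !mul1mx !mul0mx !addr0 mulmxKV //.
  by rewrite addrC subrK.
rewrite det_mulmx det_lblock det_ublock !det1 !mul1r.
by rewrite det_mx11 !mxE eqxx.
Qed.

(** Hankel matrices factor through dimension [N], so an invertible one of maximal size exists.
    Bordering it by any [u] and [v] gives a singular matrix, and its Schur complement vanishes. *)
Lemma hankel_basis N (X : 'I_d -> 'M[C]_N) c b :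
  realizes_coef X c b ->
  exists p (us vs : 'I_p -> seq 'I_d), hankel us vs [::] \in unitmx /\
    forall u v, (hrow vs u *m invmx (hankel us vs [::]) *m hcol us v) 0 0
                = h (u ++ v).
Proof.
move=> hX; pose P p := `[< exists us vs : 'I_p -> seq 'I_d,
  hankel us vs [::] \in unitmx >].
have exP : exists p, P p.
  by exists 0; apply/asboolP; exists (fun=> [::]), (fun=> [::]);
    rewrite unitmxE det_mx00 unitr1.
have ubP p : P p -> (p <= N)%N.
  move=> /asboolP[us [vs /mxrank_unit <-]].
  have -> : hankel us vs [::] = (\matrix_i (c *m wordmx X (us i))) *m
      (\matrix_(i, j) (wordmx X (vs j) *m b) i 0).
    apply/matrixP => i j; rewrite mxE -hX /= wordmx_cat !mulmxA -mulmxA !mxE.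
    by apply: eq_bigr => k _; rewrite !mxE.
  by rewrite (leq_trans (mxrankM_maxl _ _)) // rank_leq_col.
case: (ex_maxnP exP ubP) => p /asboolP[us [vs uG]] maxp.
exists p, us, vs; split => // u v; apply/eqP; rewrite eq_sym -subr_eq0.
apply: contraT => h_neq; suff: (p + 1 <= p)%N by rewrite addn1 ltnn.
apply/maxp/asboolP; exists (extend us u), (extend vs v).
rewrite hankel_extend unitmxE det_bordered // unitfE mulf_neq0 //.
by rewrite -unitfE -unitmxE.
Qed.

(** The powers of an arbitrary realization may contain parts invisible in [h]. On the Hankel basis,
    the powers are [invmx G *m hankel us vs w], so their entries are finite combinations of values
    [h (u ++ w ++ v)]. *)
Lemma null_realization N (X : 'I_d -> 'M[C]_N) c b :
  realizes_coef X c b -> level_null h ->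
  exists p (Y : 'I_d -> 'M[C]_p) c' b', realizes_coef Y c' b' /\
    forall i j, level_null (fun w => wordmx Y w i j).
Proof.
move=> /hankel_basis[p [us [vs [uG hG]]]] h0.
set G := hankel us vs [::] in uG hG.
have hankel_cat u w : hankel us vs u *m invmx G *m hankel us vs w
    = hankel us vs (u ++ w).
  apply/matrixP => i j; rewrite [RHS]mxE -catA catA -hG !mxE.
  apply: eq_bigr => k _; rewrite !mxE catA; congr (_ * _).
  by apply: eq_bigr => l _; rewrite !mxE catA.
pose Y k := invmx G *m hankel us vs [:: k].
have YE w : wordmx Y w = invmx G *m hankel us vs w.
  elim: w => [|k w IHw] /=; first by rewrite mulVmx.
  by rewrite IHw /Y -!mulmxA [X in _ *m X]mulmxA hankel_cat.
exists p, Y, (hrow vs [::]), (invmx G *m hcol us [::]); split => [w|i j].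
  rewrite YE mulmxA (_ : hrow vs [::] *m _ = hrow vs w).
    by rewrite hG cats0.
  apply/rowP => j; rewrite [RHS]mxE -[w ++ _]cat0s -hG mulmxA !mxE.
  by apply: eq_bigr => k _; rewrite !mxE.
apply: (@eq_level_null _ _ (fun w => \sum_k invmx G i k * h (us k ++ w ++ vs j))).
  by move=> w; rewrite YE mxE; apply: eq_bigr => k _; rewrite !mxE.
by apply: level_null_sum => k; apply: level_nullZ; apply: level_null_cat.
Qed.

End Hankel.

(** * The pencil [sum_k X_k (x) Z_k] and its linear systems *)

Section Pencil.
Variable C : numClosedFieldType.

(* By Cayley-Hamilton the inverse is a polynomial in the matrix. *)
Lemma invmx_ind m (A : 'M[C]_m) (P : 'M[C]_m -> Prop) :
  A \in unitmx -> P 1%:M ->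
  (forall a B D, P B -> P D -> P (a *: B + D)) ->
  (forall B, P B -> P (B *m A)) -> P (invmx A).
Proof.
(* Polynomials in a matrix need positive size; at size 0 every matrix equals [1%:M]. *)
case: m A P => [|m] A P uA P1 Plin PA.
  by move: P1; congr P; apply/matrixP => -[].
have P0 : P 0 by rewrite -[0](addNr 1%:M) -scaleN1r; apply: Plin.
have Pz a B : P B -> P (a *: B) by rewrite -[_ *: _]addr0 => PB; apply: Plin.
have Ph q : P (horner_mx A q).
  elim/poly_ind: q => [|q a IHq]; first by rewrite rmorph0.
  rewrite rmorphD rmorphM /= horner_mx_X horner_mx_C addrC -scalemx1.
  exact/Plin/PA.
have a_neq0 : (char_poly A)`_0 != 0.
  by rewrite char_poly_det mulf_neq0 ?signr_eq0 // -unitfE -unitmxE.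
have [q def_q] : exists q, char_poly A = q * 'X + ((char_poly A)`_0)%:P.
  have [q qE] : exists q, char_poly A - ((char_poly A)`_0)%:P = q * ('X - 0%:P).
    apply/factor_theorem; rewrite /root hornerD hornerN hornerC.
    by rewrite horner_coef0 subrr.
  by exists q; rewrite -['X]subr0 -qE subrK.
have := Cayley_Hamilton A; rewrite {1}def_q rmorphD rmorphM /=.
rewrite horner_mx_X horner_mx_C => /eqP; rewrite addr_eq0 => /eqP qA.
suff -> : invmx A = - ((char_poly A)`_0)^-1 *: horner_mx A q by apply: Pz.
rewrite -[RHS](mulmxK uA) -scalemxAl [horner_mx A q *m A]qA.
by rewrite scaleNr scalerN opprK scale_scalar_mx mulVf // mul1mx.
Qed.

(** The pencil acting on a column of square blocks; [pencil_stack] relates it to the Kronecker form.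
    Rectangular [X] allow block decompositions. *)
Definition pencil_act d N N' n (X : 'I_d -> 'M[C]_(N, N')) (Z : 'I_d -> 'M[C]_n)
    (Y : 'I_N' -> 'M[C]_n) (i : 'I_N) : 'M[C]_n :=
  \sum_k \sum_j X k i j *: (Z k *m Y j).

Variables (d N n : nat) (X : 'I_d -> 'M[C]_N) (Z : 'I_d -> 'M[C]_n).
Implicit Types (Y V : 'I_N -> 'M[C]_n).

Definition pencil : 'M[C]_(N * n) := \sum_k X k *t Z k.

Let stack Y : 'M[C]_(N * n, n) :=
  \matrix_(p, b) Y (mxtens_unindex p).1 (mxtens_unindex p).2 b.

Let stack_inj Y V : stack Y = stack V -> Y =1 V.
Proof.
move=> YV i; apply/matrixP => a b.
by have /matrixP/(_ (mxtens_index (i, a)) b) := YV; rewrite !mxE mxtens_indexK.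
Qed.

Let pencil_stack Y : pencil *m stack Y = stack (pencil_act X Z Y).
Proof.
rewrite /pencil mulmx_suml; apply/matrixP => p b; rewrite summxE mxE summxE.
apply: eq_bigr => k _; rewrite !mxE summxE.
case: (mxtens_indexP p) => i a; rewrite mxtens_indexK /=.
rewrite (reindex (@mxtens_index N n)) /=; last first.
  by exists (@mxtens_unindex N n) => q _; rewrite ?mxtens_indexK ?mxtens_unindexK.
rewrite (eq_bigr (fun q : 'I_N * 'I_n => X k i q.1 * (Z k a q.2 * Y q.1 q.2 b))).
  rewrite -(pair_bigA _ (fun j l => X k i j * (Z k a l * Y j l b))) /=.
  by apply: eq_bigr => j _; rewrite !mxE mulr_sumr.
by case=> j l _; rewrite tensmxE !mxE mxtens_indexK mulrA.
Qed.

(** A subspace of block columns stable under the pencil is stable under the inverse of [1 - pencil],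
    by [invmx_ind]. Applied to the kernel of an observability map and to the values of everywhere
    defined expressions. *)
Lemma pencil_solve (S : ('I_N -> 'M[C]_n) -> Prop) V :
  1%:M - pencil \in unitmx ->
  (forall a Y Y', S Y -> S Y' -> S (fun i => a *: Y i + Y' i)) ->
  (forall Y, S Y -> S (pencil_act X Z Y)) ->
  S V -> exists2 Y, S Y & forall i, Y i = V i + pencil_act X Z Y i.
Proof.
move=> uT Slin ST SV.
have [Y SY YV] : exists2 Y, S Y & invmx (1%:M - pencil) *m stack V = stack Y.
  pose P (D : 'M[C]_(N * n)) :=
    forall U, S U -> exists2 U', S U' & D *m stack U = stack U'.
  have Plin a D D' : P D -> P D' -> P (a *: D + D').
    move=> PD PD' U SU; have [U1 SU1 D1] := PD _ SU.
    have [U2 SU2 D2] := PD' _ SU; exists (fun i => a *: U1 i + U2 i); first exact: Slin.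
    by rewrite mulmxDl -scalemxAl D1 D2; apply/matrixP => p b; rewrite !mxE.
  suff: P (invmx (1%:M - pencil)) by apply.
  apply: (invmx_ind uT) => // [U SU|D PD U SU].
    by exists U; rewrite ?mul1mx.
  have [U' SU' DU'] := PD _ (Slin (-1) _ _ (ST _ SU) SU).
  exists U' => //; rewrite -mulmxA mulmxBl mul1mx pencil_stack -DU'.
  by congr (_ *m _); apply/matrixP => p b; rewrite !mxE mulN1r addrC.
exists Y => //; apply: stack_inj.
have <- : (1%:M - pencil) *m stack Y + pencil *m stack Y = stack Y.
  by rewrite -mulmxDl subrK mul1mx.
rewrite -YV mulKVmx // YV pencil_stack.
by apply/matrixP => p b; rewrite !mxE.
Qed.

Lemma pencil_solution_unique V Y Y' :
  1%:M - pencil \in unitmx ->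
  (forall i, Y i = V i + pencil_act X Z Y i) ->
  (forall i, Y' i = V i + pencil_act X Z Y' i) -> Y =1 Y'.
Proof.
have sol U : (forall i, U i = V i + pencil_act X Z U i) ->
    (1%:M - pencil) *m stack U = stack V.
  move=> UV; rewrite mulmxBl mul1mx pencil_stack.
  by apply/matrixP => p b; rewrite !mxE {1}UV mxE addrK.
move=> uT /sol YV /sol Y'V; apply: stack_inj.
by rewrite -(mulKmx uT (stack Y)) YV -Y'V mulKmx.
Qed.

Lemma pencil_power_cat m :
  wsum m.+1 (fun w => wordmx X w *t wordmx Z w) =
  pencil *m wsum m (fun w => wordmx X w *t wordmx Z w).
Proof.
rewrite wsumS /pencil mulmx_suml; apply: eq_bigr => k _.
by rewrite wsum_mulmxl; apply: eq_wsum => w _; rewrite tensmx_mul.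
Qed.

Lemma pencil_unit :
  (forall p q, null_seq
     (fun m => wsum m (fun w => wordmx X w *t wordmx Z w) p q)) ->
  1%:M - pencil \in unitmx.
Proof.
move=> T0; rewrite -row_free_unit -kermx_eq0; apply/eqP.
set T := pencil; pose K := kermx (1%:M - T).
have KT : K = K *m T.
  by apply/eqP; rewrite -subr_eq0 -{1}[K]mulmx1 -mulmxBr mulmx_ker.
have KTm m : K = K *m wsum m (fun w => wordmx X w *t wordmx Z w).
  elim: m => [|m IHm]; last by rewrite pencil_power_cat mulmxA -KT.
  rewrite wsum0 /= (_ : _ *t _ = 1%:M) ?mulmx1 //.
  apply/matrixP => p q; rewrite !mxE -natrM mulnb.
  by rewrite -(inj_eq (can_inj (@mxtens_unindexK N n)) p q) -pair_eqE.
apply/matrixP => p q; rewrite [RHS]mxE.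
have : null_seq (fun m => \sum_r `|K p r| *
    `|wsum m (fun w => wordmx X w *t wordmx Z w) r q|).
  apply: null_seq_sum => r; apply: null_seqZ => e /(T0 r q)[M TM].
  by exists M => m /TM; rewrite normr_id.
move=> /null_seq_cst; apply => m; rewrite -/K {1}(KTm m) mxE.
rewrite (le_trans (ler_norm_sum _ _ _)) //.
by apply: ler_sum => r _; rewrite normrM.
Qed.

(** The equation iterated [m] times: a truncated Neumann series and its remainder. *)
Lemma pencil_expand (b : 'cV[C]_N) Y m i :
  (forall i, Y i = (b i 0)%:M + pencil_act X Z Y i) ->
  Y i = \sum_(l < m) wsum l (fun w => (wordmx X w *m b) i 0 *: wordmx Z w)
        + wsum m (fun w => \sum_j wordmx X w i j *: (wordmx Z w *m Y j)).
Proof.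
move=> YE; elim: m => [|m ->].
  rewrite big_ord0 add0r wsum0 (bigD1 i) //= mxE eqxx scale1r mul1mx.
  rewrite big1 ?addr0 // => j ji.
  by rewrite mxE eq_sym (negbTE ji) scale0r.
rewrite big_ord_recr -addrA; congr (_ + _) => /=.
rewrite wsum_rcons -wsum_sum /wsum -big_split; apply: eq_bigr => w _ /=.
rewrite (eq_bigr (fun j => (wordmx X w i j * b j 0) *: wordmx Z w +
  \sum_k \sum_l (wordmx X w i j * X k j l) *: (wordmx Z w *m (Z k *m Y l)))); last first.
  move=> j _; rewrite [Y j]YE mulmxDr scalerDr mul_mx_scalar scalerA.
  congr (_ + _); rewrite mulmx_sumr scaler_sumr; apply: eq_bigr => k _.
  rewrite mulmx_sumr scaler_sumr; apply: eq_bigr => l _.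
  by rewrite -scalemxAr scalerA.
rewrite big_split mxE scaler_suml /=; congr (_ + _).
rewrite exchange_big /=; apply: eq_bigr => k _.
rewrite exchange_big /=; apply: eq_bigr => l _.
by rewrite !wordmx_rcons mxE scaler_suml -mulmxA.
Qed.

End Pencil.

Section PencilAlgebra.
Variables (C : numClosedFieldType) (d N n : nat).
Variables (X : 'I_d -> 'M[C]_N) (Z : 'I_d -> 'M[C]_n).

(* The kernel of the observability map [V |-> (c X^w V)_w] is invariant under
   the pencil, hence under the inverse of [1 - pencil X Z]. *)
Lemma pencil_output0 (c : 'rV[C]_N) (b : 'cV[C]_N) (Y : 'I_N -> 'M[C]_n) :
  1%:M - pencil X Z \in unitmx ->
  (forall w, (c *m wordmx X w *m b) 0 0 = 0) ->
  (forall i, Y i = (b i 0)%:M + pencil_act X Z Y i) ->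
  \sum_i c 0 i *: Y i = 0.
Proof.
move=> uT cXb YE.
pose S (V : 'I_N -> 'M[C]_n) :=
  forall w, \sum_i (c *m wordmx X w) 0 i *: V i = 0.
have [] := @pencil_solve _ _ _ _ X Z S (fun i => (b i 0)%:M) uT.
- move=> a V V' SV SV' w.
  transitivity (a *: (\sum_i (c *m wordmx X w) 0 i *: V i) +
    \sum_i (c *m wordmx X w) 0 i *: V' i); last first.
    by rewrite SV SV' scaler0 addr0.
  rewrite scaler_sumr -big_split; apply: eq_bigr => i _ /=.
  by rewrite scalerDr !scalerA mulrC.
- move=> V SV w.
  transitivity (\sum_k Z k *m \sum_j (c *m wordmx X (rcons w k)) 0 j *: V j).
    rewrite (eq_bigr (fun i => \sum_k \sum_j
        ((c *m wordmx X w) 0 i * X k i j) *: (Z k *m V j))); last first.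
      move=> i _; rewrite /pencil_act scaler_sumr; apply: eq_bigr => k _.
      by rewrite scaler_sumr; apply: eq_bigr => j _; rewrite scalerA.
    rewrite exchange_big /=; apply: eq_bigr => k _.
    rewrite exchange_big mulmx_sumr /=; apply: eq_bigr => j _.
    by rewrite wordmx_rcons mulmxA -scalemxAr -scaler_suml [in RHS]mxE.
  by rewrite big1 // => k _; rewrite SV mulmx0.
- move=> w; transitivity (((c *m wordmx X w *m b) 0 0)%:M : 'M[C]_n); last first.
    by rewrite cXb raddf0.
  rewrite [in RHS]mxE raddf_sum; apply: eq_bigr => i _.
  by rewrite scale_scalar_mx.
move=> V SV VE; rewrite -[RHS](SV [::]); apply: eq_bigr => i _.
by rewrite mulmx1 (pencil_solution_unique uT YE VE).
Qed.

End PencilAlgebra.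

(** * Pencils with null powers at word-isometric tuples *)

Section ContractivePencil.
Variables (C : numClosedFieldType) (d N n : nat).
Variables (X : 'I_d -> 'M[C]_N) (A : 'I_d -> 'M[C]_n).
Hypothesis X_null : forall i j, level_null (fun w => wordmx X w i j).
Hypothesis isoA : word_isometric A.

Let X_Z_null i j a b : null_seq (fun m =>
  wsum m (fun w => wordmx X w i j * wordmx (conj_tup A) w a b)).
Proof.
apply: (level_null_pairing (c := n%:R) (X_null i j)) => m.
exact: wsum_conj_wordmx_entry.
Qed.

Lemma contractive_pencil_unit : 1%:M - pencil X (conj_tup A) \in unitmx.
Proof.
apply: pencil_unit => p q.
case: (mxtens_indexP p) => i a; case: (mxtens_indexP q) => j b.
apply: eq_null_seq (X_Z_null i j a b) => m.
by rewrite /wsum summxE; apply: eq_bigr => w _; rewrite tensmxE.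
Qed.

(** The difference is exactly the remainder in [pencil_expand], a fixed linear combination of the
    null sequences [X_Z_null]. *)
Lemma contractive_pencil_limit (h : seq 'I_d -> C) c b (Y : 'I_N -> 'M[C]_n) :
  realizes_coef h X c b ->
  (forall i, Y i = (b i 0)%:M + pencil_act X (conj_tup A) Y i) ->
  forall i j, null_seq (fun m => (\sum_i c 0 i *: Y i - \sum_(l < m)
    wsum l (fun w => h w *: wordmx (conj_tup A) w)) i j).
Proof.
move=> hX YE a b'.
have : null_seq (fun m => \sum_i \sum_j \sum_k (c 0 i * Y j k b') *
    wsum m (fun w => wordmx X w i j * wordmx (conj_tup A) w a k)).
  by do 3 apply: null_seq_sum => ?; apply: null_seqZ.
apply: eq_null_seq => m.
rewrite (eq_bigr (fun i => \sum_(l < m) wsum l (fun w => (c 0 i * (wordmx X w *m b) i 0) *: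
      wordmx (conj_tup A) w) + c 0 i *: wsum m (fun w => \sum_j wordmx X w i j *:
      (wordmx (conj_tup A) w *m Y j)))); last first.
  move=> i _; rewrite {1}(pencil_expand m i YE) scalerDr; congr (_ + _).
  rewrite scaler_sumr; apply: eq_bigr => l _; rewrite /wsum scaler_sumr.
  by apply: eq_bigr => w _; rewrite scalerA.
rewrite big_split /= [X in X + _ - _]exchange_big /=.
rewrite [X in X + _ - _](_ : _ = \sum_(l < m) wsum l
    (fun w => h w *: wordmx (conj_tup A) w)); last first.
  apply: eq_bigr => l _.
  rewrite -wsum_sum; apply: eq_wsum => w _.
  by rewrite -scaler_suml -hX -mulmxA mxE.
rewrite addrC addKr summxE; apply: eq_bigr => i _.
transitivity (wsum m (fun w => \sum_j \sum_k (c 0 i * Y j k b') *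
    (wordmx X w i j * wordmx (conj_tup A) w a k))).
  rewrite wsum_sum; apply: eq_bigr => j _; rewrite wsum_sum.
  by apply: eq_bigr => k _; rewrite /wsum mulr_sumr.
rewrite mxE summxE mulr_sumr; apply: eq_bigr => w _; rewrite summxE mulr_sumr.
apply: eq_bigr => j _; rewrite !mxE !mulr_sumr; apply: eq_bigr => k _; ring.
Qed.

End ContractivePencil.

(** * Noncommutative rational expressions *)

Section RationalPaths.
Variables (R : realType) (d : nat).
Local Notation C := R[i].
Implicit Types (s : ncexpr R d).

(** A unital homomorphism carries inverses to inverses. Used for Kronecker amplifications and for
    the embedding of scalars. *)
Lemma nceval_hom n m (phi : 'M[C]_n -> 'M[C]_m) s (Z : mxtup R d n) :
  (forall a, phi a%:M = a%:M) -> {morph phi : A B / A + B} ->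
  {morph phi : A B / A *m B} -> ncdom s Z ->
  ncdom s (fun k => phi (Z k)) /\ nceval s (fun k => phi (Z k)) = phi (nceval s Z).
Proof.
move=> phi1 phiD phiM; elim: s => //=.
- move=> s1 IH1 s2 IH2 /andP[/IH1[-> ->] /IH2[-> ->]].
  by rewrite phiD.
- move=> s1 IH1 s2 IH2 /andP[/IH1[-> ->] /IH2[-> ->]].
  by rewrite phiM.
move=> s1 IH1 /andP[/IH1[-> ->] us] /=.
have inv : phi (nceval s1 Z) *m phi (invmx (nceval s1 Z)) = 1%:M.
  by rewrite -phiM mulmxV.
have [u _] := mulmx1_unit inv; split=> //.
by rewrite -[RHS](mulKmx u) inv mulmx1.
Qed.

Definition path_tup n (P : 'I_d -> 'M[{poly C}]_n) (t : C) : mxtup R d n :=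
  fun k => map_mx (horner_eval t) (P k).

(** Along a polynomial path an expression is a matrix of rational functions of [t]; [q] is a common
    denominator that does not vanish at [t0]. *)
Lemma nceval_path n (P : 'I_d -> 'M[{poly C}]_n) s t0 :
  ncdom s (path_tup P t0) ->
  exists (q : {poly C}) (M : 'M[{poly C}]_n), q.[t0] != 0 /\
    forall t, q.[t] != 0 -> ncdom s (path_tup P t) /\
      q.[t] *: nceval s (path_tup P t) = map_mx (horner_eval t) M.
Proof.
elim: s => [k _|a _|s1 IH1 s2 IH2|s1 IH1 s2 IH2|s1 IH1] /=.
- exists 1, (P k); rewrite hornerC oner_neq0; split=> // t _.
  by rewrite hornerC scale1r.
- exists 1, (a%:P)%:M; rewrite hornerC oner_neq0; split=> // t _.
  by rewrite hornerC scale1r map_scalar_mx /= /horner_eval hornerC.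
- move=> /andP[/IH1[q1 [M1 [q1t M1P]]] /IH2[q2 [M2 [q2t M2P]]]].
  exists (q1 * q2), (q2 *: M1 + q1 *: M2); split.
    by rewrite hornerM mulf_neq0.
  move=> t; rewrite hornerM mulf_eq0 negb_or => /andP[/M1P[-> E1] /M2P[-> E2]].
  split=> //; rewrite map_mxD !map_mxZ -E1 -E2 /= /horner_eval.
  by rewrite scalerDr !scalerA [q2.[t] * _]mulrC.
- move=> /andP[/IH1[q1 [M1 [q1t M1P]]] /IH2[q2 [M2 [q2t M2P]]]].
  exists (q1 * q2), (M1 *m M2); split.
    by rewrite hornerM mulf_neq0.
  move=> t; rewrite hornerM mulf_eq0 negb_or => /andP[/M1P[-> E1] /M2P[-> E2]].
  by split=> //; rewrite map_mxM -E1 -E2 -scalemxAl -scalemxAr scalerA.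
move=> /andP[/IH1[q [M [qt MP]]] us].
have detM t : q.[t] != 0 -> (\det M).[t] = q.[t] ^+ n * \det (nceval s1 (path_tup P t)).
  move=> qt'; rewrite -detZ (proj2 (MP t qt')).
  by rewrite -[(\det M).[t]]/(horner_eval t (\det M)) -det_map_mx.
(* Cramer's rule for the value [M / q], whose inverse is [q *: \adj M] divided by [\det M]. *)
exists (q * \det M), (q ^+ 2 *: \adj M); split.
  rewrite hornerM detM //; apply: mulf_neq0 => //; apply: mulf_neq0.
    exact: expf_neq0.
  by rewrite -unitfE -unitmxE.
move=> t; rewrite hornerM mulf_eq0 negb_or => /andP[qt' dt].
have [-> E] := MP t qt'.
have ut : nceval s1 (path_tup P t) \in unitmx.
  by move: dt; rewrite detM // mulf_eq0 negb_or unitmxE unitfE => /andP[].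
rewrite ut; split=> //; rewrite map_mxZ map_mx_adj -E.
rewrite -[LHS](mulmxK ut) -[RHS](mulmxK ut); congr (_ *m _).
rewrite -!scalemxAl mulVmx //= /horner_eval horner_exp expr2 -[RHS]scalerA.
rewrite [X in _ = _ *: X]scalemxAr mul_adj_mx detZ -detM //.
by rewrite -scalerA scalemx1.
Qed.

Lemma poly_horner_eq0 (p : {poly C}) : (forall t, p.[t] = 0) -> p = 0.
Proof.
move=> p0; apply/eqP; apply: contraT => p_neq0.
have := max_poly_roots p_neq0 (_ : all _ [seq (i%:R : C) | i <- iota 0 (size p)]).
rewrite size_map size_iota ltnn; apply.
  by apply/allP => x _; rewrite /root p0.
rewrite map_inj_uniq ?iota_uniq // => i j /eqP.
by rewrite eqr_nat => /eqP.
Qed.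

(** After clearing denominators, agreement for all but finitely many [t] is a polynomial identity,
    which can be evaluated at [t0]. *)
Lemma nceval_path_eq n (P : 'I_d -> 'M[{poly C}]_n) (g : {poly C}) s1 s2 t0 :
  g != 0 -> ncdom s1 (path_tup P t0) -> ncdom s2 (path_tup P t0) ->
  (forall t, g.[t] != 0 -> ncdom s1 (path_tup P t) -> ncdom s2 (path_tup P t) ->
     nceval s1 (path_tup P t) = nceval s2 (path_tup P t)) ->
  nceval s1 (path_tup P t0) = nceval s2 (path_tup P t0).
Proof.
move=> g_neq0 /nceval_path[q1 [M1 [q1t M1P]]] /nceval_path[q2 [M2 [q2t M2P]]] eqs.
have q_neq0 (q : {poly C}) : q.[t0] != 0 -> q != 0.
  by apply: contra_neq => ->; rewrite horner0.
have qM : q2 *: M1 = q1 *: M2.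
  apply/matrixP => i j; apply/eqP; rewrite -subr_eq0 !mxE.
  suff /eqP : g * (q1 * q2) * (q2 * M1 i j - q1 * M2 i j) = 0.
    by rewrite !mulf_eq0 (negbTE g_neq0) (negbTE (q_neq0 _ q1t)) (negbTE (q_neq0 _ q2t)).
  apply: poly_horner_eq0 => t; rewrite !hornerM hornerD hornerN !hornerM.
  have [->|gt] := eqVneq g.[t] 0; first by rewrite !mul0r.
  have [->|q1t'] := eqVneq q1.[t] 0; first by rewrite !(mul0r, mulr0).
  have [->|q2t'] := eqVneq q2.[t] 0; first by rewrite !(mul0r, mulr0).
  have [d1 E1] := M1P t q1t'; have [d2 E2] := M2P t q2t'.
  have -> : (M1 i j).[t] = (map_mx (horner_eval t) M1) i j by rewrite mxE.
  have -> : (M2 i j).[t] = (map_mx (horner_eval t) M2) i j by rewrite mxE.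
  by rewrite -E1 -E2 (eqs t gt d1 d2) !mxE [q1.[t] * (q2.[t] * _)]mulrCA subrr mulr0.
have [d1 E1] := M1P t0 q1t; have [d2 E2] := M2P t0 q2t.
have q12 : q1.[t0] * q2.[t0] != 0 by rewrite mulf_neq0.
apply: (scalerI q12); rewrite [in LHS]mulrC -!scalerA E1 E2.
by have /(congr1 (map_mx (horner_eval t0))) := qM; rewrite !map_mxZ.
Qed.

(** The middle expression may be undefined at [Z]. A line joins [Z (x) 1] to [1 (x) Z0] with [Z0] in
    the domain of [s2]; for all but finitely many points of it [s2] is defined, and [nceval_path_eq]
    carries the equality back to [Z (x) 1]. *)
Lemma nc_equiv_trans s1 s2 s3 :
  nc_nondeg s2 -> nc_equiv s1 s2 -> nc_equiv s2 s3 -> nc_equiv s1 s3.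
Proof.
move=> [m [Z0 [m0 dom2]]] e12 e23 n Z dom1 dom3.
pose P k : 'M[{poly C}]_(n * m) := 'X *: map_mx polyC (Z k *t 1%:M)
  + (1 - 'X) *: map_mx polyC (1%:M *t Z0 k).
have mapK t p q (A : 'M[C]_(p, q)) : map_mx (horner_eval t) (map_mx polyC A) = A.
  by apply/matrixP => i j; rewrite !mxE /horner_eval hornerC.
have P1 : path_tup P 1 = fun k => Z k *t 1%:M.
  apply/funext => k; rewrite /path_tup map_mxD !map_mxZ !mapK /= /horner_eval.
  by rewrite hornerX hornerD hornerN hornerX hornerC subrr scale1r scale0r addr0.
have P0 : path_tup P 0 = fun k => 1%:M *t Z0 k.
  apply/funext => k; rewrite /path_tup map_mxD !map_mxZ !mapK /= /horner_eval.
  by rewrite hornerX hornerD hornerN hornerX hornerC subr0 scale1r scale0r add0r.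
have tens1 (a b : nat) (c : C) : (c%:M : 'M[C]_a) *t (1%:M : 'M[C]_b) = c%:M.
  apply/matrixP => p q; rewrite !mxE.
  rewrite -(inj_eq (can_inj (@mxtens_unindexK a b)) p q) -pair_eqE /=.
  by case: eqP; case: eqP => //=; rewrite ?mulr1 ?mulr0 ?mul0r.
have tens2 (a b : nat) (c : C) : (1%:M : 'M[C]_a) *t (c%:M : 'M[C]_b) = c%:M.
  apply/matrixP => p q; rewrite !mxE.
  rewrite -(inj_eq (can_inj (@mxtens_unindexK a b)) p q) -pair_eqE /=.
  by case: eqP; case: eqP => //=; rewrite ?mul1r ?mulr0 ?mul0r.
have homl s : ncdom s Z -> ncdom s (path_tup P 1) /\
    nceval s (path_tup P 1) = nceval s Z *t 1%:M.
  rewrite P1; apply: (@nceval_hom _ _ (fun A => A *t 1%:M)) => [a|A B|A B].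
  - exact: tens1.
  - by apply/matrixP => i j; rewrite !mxE mulrDl.
  - by rewrite tensmx_mul mulmx1.
have dom2' : ncdom s2 (path_tup P 0).
  rewrite P0; apply: (proj1 (@nceval_hom _ _ (fun A => 1%:M *t A) _ _ _ _ _ dom2))
    => [a|A B|A B].
  - exact: tens2.
  - by apply/matrixP => i j; rewrite !mxE mulrDr.
  - by rewrite tensmx_mul mulmx1.
have [d1 E1] := homl _ dom1; have [d3 E3] := homl _ dom3.
have [q2 [M2 [q2t M2P]]] := nceval_path dom2'.
have q2_neq0 : q2 != 0 by apply: contra_neq q2t => ->; rewrite horner0.
have : nceval s1 (path_tup P 1) = nceval s3 (path_tup P 1).
  apply: (nceval_path_eq q2_neq0) => // t /M2P[d2 _] d1' d3'.
  by rewrite e12 // e23.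
rewrite E1 E3 => /matrixP E; apply/matrixP => i j.
(* The positive size [m] provides a diagonal position at which [A *t 1%:M] shows the entry
   [A i j]. *)
have := E (mxtens_index (i, Ordinal m0)) (mxtens_index (j, Ordinal m0)).
by rewrite !tensmxE mxE eqxx !mulr1.
Qed.

End RationalPaths.

(** * Block calculus for pencils *)

Section PencilBlocks.
Variables (C : numClosedFieldType) (d n : nat).
Implicit Types (Z : 'I_d -> 'M[C]_n).

Definition col_fam N1 N2 (Y1 : 'I_N1 -> 'M[C]_n) (Y2 : 'I_N2 -> 'M[C]_n)
    (i : 'I_(N1 + N2)) : 'M[C]_n :=
  match fintype.split i with inl i1 => Y1 i1 | inr i2 => Y2 i2 end.

Lemma sum_col_fam N1 N2 (Y1 : 'I_N1 -> 'M[C]_n) (Y2 : 'I_N2 -> 'M[C]_n)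
    (c1 : 'rV[C]_N1) (c2 : 'rV[C]_N2) :
  \sum_i row_mx c1 c2 0 i *: col_fam Y1 Y2 i =
  \sum_i c1 0 i *: Y1 i + \sum_i c2 0 i *: Y2 i.
Proof.
rewrite big_split_ord /=; congr (_ + _); apply: eq_bigr => i _.
  by rewrite row_mxEl /col_fam (unsplitK (inl i)).
by rewrite row_mxEr /col_fam (unsplitK (inr i)).
Qed.

Lemma pencil_act_block N1 N2 M1 M2 (X11 : 'I_d -> 'M[C]_(N1, M1))
    (X12 : 'I_d -> 'M[C]_(N1, M2)) (X21 : 'I_d -> 'M[C]_(N2, M1))
    (X22 : 'I_d -> 'M[C]_(N2, M2)) Z Y1 Y2 i :
  pencil_act (fun k => block_mx (X11 k) (X12 k) (X21 k) (X22 k)) Z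
    (col_fam Y1 Y2) i =
  match fintype.split i with
  | inl i1 => pencil_act X11 Z Y1 i1 + pencil_act X12 Z Y2 i1
  | inr i2 => pencil_act X21 Z Y1 i2 + pencil_act X22 Z Y2 i2
  end.
Proof.
rewrite /pencil_act -[i in LHS]splitK; case: (fintype.split i) => i' /=;
  rewrite -big_split; apply: eq_bigr => k _;
  rewrite big_split_ord /=; congr (_ + _); apply: eq_bigr => j _;
  rewrite ?(block_mxEul, block_mxEur, block_mxEdl, block_mxEdr) /col_fam.
- by rewrite (unsplitK (inl j)).
- by rewrite (unsplitK (inr j)).
- by rewrite (unsplitK (inl j)).
by rewrite (unsplitK (inr j)).
Qed.

Lemma pencil_act_mull N M P (D : 'M[C]_(P, N)) (X : 'I_d -> 'M[C]_(N, M)) Z Y i :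
  pencil_act (fun k => D *m X k) Z Y i = \sum_j D i j *: pencil_act X Z Y j.
Proof.
rewrite /pencil_act.
under [RHS]eq_bigr do rewrite scaler_sumr.
rewrite [RHS]exchange_big /=; apply: eq_bigr => k _.
under [RHS]eq_bigr do rewrite scaler_sumr.
rewrite [RHS]exchange_big /=; apply: eq_bigr => l _.
by rewrite mxE scaler_suml; apply: eq_bigr => j _; rewrite scalerA.
Qed.

Lemma pencil_act_mulr N M (X : 'I_d -> 'M[C]_(N, M)) Z Y V i :
  pencil_act X Z (fun j => Y j *m V) i = pencil_act X Z Y i *m V.
Proof.
rewrite /pencil_act mulmx_suml; apply: eq_bigr => k _.
rewrite mulmx_suml; apply: eq_bigr => j _.
by rewrite -scalemxAl mulmxA.
Qed.

Lemma pencil_act0 N M Z Y i :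
  pencil_act (fun=> 0 : 'M[C]_(N, M)) Z Y i = 0.
Proof.
by rewrite /pencil_act big1 // => k _; rewrite big1 // => j _; rewrite mxE scale0r.
Qed.

Lemma pencil_actB N M (X X' : 'I_d -> 'M[C]_(N, M)) Z Y i :
  pencil_act (fun k => X k - X' k) Z Y i =
  pencil_act X Z Y i - pencil_act X' Z Y i.
Proof.
rewrite /pencil_act -sumrB; apply: eq_bigr => k _; rewrite -sumrB.
by apply: eq_bigr => j _; rewrite !mxE scalerBl.
Qed.

End PencilBlocks.

(** * State-space realization of rational expressions *)

Section Realization.
Variables (R : realType) (d : nat).
Local Notation C := R[i].
Implicit Types (s : ncexpr R d).

(** The transfer function [c (1 - pencil)^-1 b], phrased through a solution [Y] of the linear system
    so that it makes sense on the whole domain of [s]. *)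
Definition realizes s N (X : 'I_d -> 'M[C]_N) (c : 'rV[C]_N) (b : 'cV[C]_N) :=
  forall n (Z : mxtup R d n), ncdom s Z -> exists Y : 'I_N -> 'M[C]_n,
    (forall i, Y i = (b i 0)%:M + pencil_act X Z Y i) /\
    nceval s Z = \sum_i c 0 i *: Y i.

Let zero_tup n : mxtup R d n := fun=> 0.

Let realizes_at0 s N (X : 'I_d -> 'M[C]_N) c b :
  realizes s X c b -> ncdom s (zero_tup 1) ->
  nceval s (zero_tup 1) = c *m b.
Proof.
move=> sX /sX[Y [YE ->]]; apply/matrixP => i j; rewrite !ord1 summxE mxE.
apply: eq_bigr => k _; rewrite !mxE YE /pencil_act big1 => [|l _].
  by rewrite addr0 mxE eqxx.
by rewrite big1 // => m _; rewrite mul0mx scaler0.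
Qed.

(** Structural induction with the usual system interconnections. Definedness at 0 makes the value
    [c *m b] there nonzero whenever an inverse is taken. *)
Lemma ncexpr_realization s : ncdom s (zero_tup 1) ->
  exists N (X : 'I_d -> 'M[C]_N) c b, realizes s X c b.
Proof.
elim: s => [k _|a _|s1 IH1 s2 IH2|s1 IH1 s2 IH2|s1 IH1] /=.
- exists (1 + 1)%N, (fun l => block_mx 0 (l == k)%:R%:M 0 0), (row_mx 1%:M 0),
    (col_mx 0 1%:M).
  move=> n Z _; exists (col_fam (fun=> Z k) (fun=> 1%:M)); split=> [i|].
    rewrite (pencil_act_block (fun=> 0) (fun l => (l == k)%:R%:M) (fun=> 0) (fun=> 0)).
    rewrite /col_fam mxE; case: (fintype.split i) => j; rewrite !pencil_act0 !mxE.
      rewrite !(raddf0, add0r) /pencil_act (bigD1 k) //= big_ord1 eqxx ord1.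
      rewrite !mxE eqxx scale1r mulmx1 big1 ?addr0 // => l lk.
      by rewrite big_ord1 (negbTE lk) !mxE mul0rn scale0r.
    by rewrite !addr0 ord1 eqxx.
  by rewrite sum_col_fam !big_ord1 !mxE eqxx scale1r scale0r addr0.
- exists 1%N, (fun=> 0), a%:M, 1%:M => n Z _; exists (fun=> 1%:M); split=> [i|].
    by rewrite pencil_act0 addr0 ord1 mxE eqxx.
  by rewrite big_ord1 mxE eqxx mulr1n scalemx1.
- move=> /andP[/IH1[N1 [X1 [c1 [b1 sX1]]]] /IH2[N2 [X2 [c2 [b2 sX2]]]]].
  exists (N1 + N2)%N, (fun k => block_mx (X1 k) 0 0 (X2 k)),
    (row_mx c1 c2), (col_mx b1 b2).
  move=> n Z /= /andP[/sX1[Y1 [Y1E ->]] /sX2[Y2 [Y2E ->]]].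
  exists (col_fam Y1 Y2); split=> [i|]; last by rewrite sum_col_fam.
  rewrite (pencil_act_block X1 (fun=> 0) (fun=> 0) X2) mxE /col_fam.
  by case: (fintype.split i) => j; rewrite pencil_act0 ?addr0 ?add0r.
- move=> /andP[/IH1[N1 [X1 [c1 [b1 sX1]]]] /IH2[N2 [X2 [c2 [b2 sX2]]]]].
  (* Cascade of the two systems: the first gets states [Y1 i *m V], with [V] the value of [s2], and
     [V] is itself expanded by the equation for [Y2]. *)
  exists (N1 + N2)%N, (fun k => block_mx (X1 k) (b1 *m c2 *m X2 k) 0 (X2 k)),
    (row_mx c1 0), (col_mx (b1 *m (c2 *m b2)) b2).
  move=> n Z /= /andP[/sX1[Y1 [Y1E ->]] /sX2[Y2 [Y2E ->]]].
  set V := \sum_i c2 0 i *: Y2 i.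
  exists (col_fam (fun i => Y1 i *m V) Y2); split=> [i|]; last first.
    rewrite sum_col_fam [X in _ + X]big1 => [|i _]; last by rewrite mxE scale0r.
    by rewrite addr0 mulmx_suml; apply: eq_bigr => i _; rewrite scalemxAl.
  rewrite (pencil_act_block X1 (fun k => b1 *m c2 *m X2 k) (fun=> 0) X2) mxE /col_fam.
  case: (fintype.split i) => j; last by rewrite pencil_act0 add0r.
  rewrite pencil_act_mulr pencil_act_mull {1}Y1E mulmxDl [LHS]addrC [RHS]addrCA.
  congr (_ + _).
  have VE : V = ((c2 *m b2) 0 0)%:M + \sum_j c2 0 j *: pencil_act X2 Z Y2 j.
    rewrite mxE raddf_sum -big_split; apply: eq_bigr => k _ /=.
    by rewrite {1}Y2E scalerDr scale_scalar_mx.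
  rewrite mul_scalar_mx {1}VE scalerDr scale_scalar_mx; congr (_%:M + _).
    by rewrite [RHS]mxE big_ord1.
  rewrite scaler_sumr; apply: eq_bigr => k _.
  by rewrite scalerA mxE big_ord1.

move=> /andP[dom0 u0]; have [N [X [c [b sX]]]] := IH1 dom0.
move: u0; rewrite (realizes_at0 sX dom0) unitmxE det_mx11 unitfE.
set a := (c *m b) 0 0 => a_neq0.
(* The states are [Y i *m V] and the inverse [V] itself. The relation [\sum_i c 0 i *: Y' i = 1%:M]
   is solved for [V], dividing by [a]. *)
exists (N + 1)%N, (fun k => block_mx (X k - a^-1 *: (b *m c) *m X k) 0
                              (- (a^-1 *: c *m X k)) 0),
  (row_mx 0 1%:M), (col_mx (a^-1 *: b) a^-1%:M) => n Z /= /andP[/sX[Y [YE ->]]].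
set S := \sum_i _ => uS; set V := invmx S.
pose Y' i := Y i *m V.
have Y'E i : Y' i = b i 0 *: V + pencil_act X Z Y' i.
  by rewrite /Y' pencil_act_mulr {1}YE mulmxDl mul_scalar_mx.
have VE : V = a^-1%:M - a^-1 *: \sum_i c 0 i *: pencil_act X Z Y' i.
  have : \sum_i c 0 i *: Y' i = 1%:M.
    rewrite -(mulmxV uS) mulmx_suml; apply: eq_bigr => i _.
    by rewrite scalemxAl.
  rewrite (eq_bigr (fun i => (c 0 i * b i 0) *: V +
      c 0 i *: pencil_act X Z Y' i)) => [|i _].
    rewrite big_split /= -scaler_suml (_ : \sum_i _ * _ = a); last by rewrite /a mxE.
    move=> /(canRL (addrK _)) /(congr1 (fun A => a^-1 *: A)).
    by rewrite scalerA mulVf // scale1r scalerBr scalemx1.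
  by rewrite {1}Y'E scalerDr scalerA.
exists (col_fam Y' (fun=> V)); split=> [i|]; last first.
  rewrite sum_col_fam big1 => [|i _]; last by rewrite mxE scale0r.
  by rewrite add0r big_ord1 mxE eqxx scale1r.
rewrite (pencil_act_block (fun k => X k - a^-1 *: (b *m c) *m X k) (fun=> 0)
  (fun k => - (a^-1 *: c *m X k)) (fun=> 0)) mxE /col_fam.
have negE : pencil_act (fun k => - (a^-1 *: c *m X k)) Z Y' 0 =
    - (a^-1 *: \sum_i c 0 i *: pencil_act X Z Y' i).
  transitivity (pencil_act (fun k => (- (a^-1 *: c)) *m X k) Z Y' 0).
    by apply: eq_bigr => k _; rewrite mulNmx.
  rewrite pencil_act_mull scaler_sumr -sumrN; apply: eq_bigr => l _.
  by rewrite !mxE scaleNr scalerA.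
case: (fintype.split i) => j; rewrite pencil_act0 addr0; last first.
  by rewrite ord1 negE mxE eqxx.
rewrite pencil_actB pencil_act_mull Y'E addrCA [LHS]addrC; congr (_ + _).
rewrite {1}VE scalerBr scale_scalar_mx mxE mulrC; congr (_ - _).
rewrite !scaler_sumr; apply: eq_bigr => k _.
by rewrite !mxE big_ord1 !scalerA mulrCA mulrA.
Qed.

End Realization.

(** * Taylor coefficients of expressions and of [b] *)

Section Taylor.
Variables (R : realType) (d : nat).
Local Notation C := R[i].
Local Open Scope sesquilinear_scope.
Local Open Scope classical_set_scope.
Implicit Types (s : ncexpr R d).

Let wordmx_block N1 N2 (X1 : 'I_d -> 'M[C]_N1) (X2 : 'I_d -> 'M[C]_N2) w :
  wordmx (fun k => block_mx (X1 k) 0 0 (X2 k)) w =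
  block_mx (wordmx X1 w) 0 0 (wordmx X2 w).
Proof.
elim: w => [|k w IHw] /=; first by rewrite -scalar_mx_block.
by rewrite IHw mulmx_block !(mul0mx, mulmx0, addr0, add0r).
Qed.

(** The block-diagonal system with output [(c1, - c2)] realizes the difference and has zero
    coefficients. On the line [t Z], [pencil_output0] applies off the roots of [g], which is nonzero
    because [g.[0] = 1]. *)
Lemma realizes_equiv s1 s2 N1 N2 (X1 : 'I_d -> 'M[C]_N1) (X2 : 'I_d -> 'M[C]_N2)
    c1 c2 b1 b2 :
  realizes s1 X1 c1 b1 -> realizes s2 X2 c2 b2 ->
  (forall w, (c1 *m wordmx X1 w *m b1) 0 0 = (c2 *m wordmx X2 w *m b2) 0 0) ->
  nc_equiv s1 s2.
Proof.
move=> sX1 sX2 coef n Z dom1 dom2.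
pose X k := block_mx (X1 k) 0 0 (X2 k).
pose P k : 'M[{poly C}]_n := 'X *: map_mx polyC (Z k).
have PE t : path_tup P t = fun k => t *: Z k.
  apply/funext => k; apply/matrixP => i j.
  by rewrite !mxE /horner_eval hornerM hornerX hornerC.
have P1 : path_tup P 1 = Z.
  by rewrite PE; apply/funext => k; rewrite scale1r.
pose g := \det (1%:M - 'X *: map_mx polyC (pencil X Z)).
have gE t : g.[t] = \det (1%:M - pencil X (path_tup P t)).
  rewrite -[g.[t]]/(horner_eval t g) -det_map_mx; congr (\det _).
  apply/matrixP => i j; rewrite !mxE /= /horner_eval !(hornerE, hornerMn).
  congr (_ - _); rewrite PE /pencil !summxE mulr_sumr; apply: eq_bigr => k _.
  by rewrite !mxE mulrCA.
have g_neq0 : g != 0.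
  suff : g.[0] != 0 by apply: contra_neq => ->; rewrite horner0.
  rewrite gE PE (_ : pencil _ _ = 0) ?subr0 ?det1 ?oner_neq0 //.
  by rewrite /pencil big1 // => k _; rewrite scale0r tensmx0.
rewrite -P1 in dom1 dom2 *; apply: (nceval_path_eq g_neq0) => // t.
rewrite gE -unitfE -unitmxE => ut /sX1[Y1 [Y1E ->]] /sX2[Y2 [Y2E ->]].
apply/eqP; rewrite -subr_eq0; apply/eqP.
transitivity (\sum_i row_mx c1 (- c2) 0 i *: col_fam Y1 Y2 i).
  rewrite sum_col_fam; congr (_ + _); rewrite -sumrN; apply: eq_bigr => i _.
  by rewrite mxE scaleNr.
apply: (pencil_output0 (b := col_mx b1 b2) ut) => [w|i].
  rewrite wordmx_block mul_row_block !(mulmx0, addr0, add0r) mul_row_col.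
  by rewrite !mulNmx mxE [X in _ + X]mxE coef subrr.
rewrite /X (pencil_act_block X1 (fun=> 0) (fun=> 0) X2) mxE /col_fam.
by case: (fintype.split i) => j; rewrite pencil_act0 ?addr0 ?add0r.
Qed.

(* The weighted path [0 -> 1 -> ... -> size w] with letters [w]: its powers
   single out the coefficient of [w]. *)
Let word_tup (w : seq 'I_d) (t : C) : mxtup R d (size w).+1 := fun k =>
  \matrix_(i, j) (t *+ ((j == i.+1 :> nat) && (onth w i == Some k))).

Let word_tup_mul w t k n (M : 'M[C]_((size w).+1, n)) (i j : 'I_(size w).+1) l :
  (j == i.+1 :> nat) ->
  (word_tup w t k *m M) i l = t *+ (onth w i == Some k) * M j l.
Proof.
move=> /eqP ij; rewrite mxE (bigD1 j) //= mxE ij eqxx big1 ?addr0 // => j' jj'.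
rewrite mxE -ij (_ : (j' == j :> nat) = false) ?mulr0n ?mul0r //.
by apply/negbTE.
Qed.

Let word_tup_mul_last w t k n (M : 'M[C]_((size w).+1, n)) l :
  (word_tup w t k *m M) ord_max l = 0.
Proof.
rewrite mxE big1 // => j _; rewrite mxE (_ : (j == _ :> nat) = false) ?mul0r //.
by rewrite ltn_eqF // ltn_ord.
Qed.

Let word_tup_pow w t v (i : 'I_(size w).+1) :
  mxpow (word_tup w t) v i ord_max = t ^+ size v *+ (drop i w == v).
Proof.
elim: v i => [|k v IHv] i /=.
  rewrite mxE expr0 -val_eqE /= -size_eq0 size_drop subn_eq0.
  by rewrite eqn_leq -ltnS ltn_ord.
have [iw|wi] := ltnP i (size w).
  rewrite (@word_tup_mul w t k _ _ i (Ordinal (_ : i.+1 < (size w).+1)%N)) //.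
  rewrite IHv /= exprS mulrnAl mulrnAr -mulrnA mulnb; congr (_ *+ _).
  rewrite (drop_nth k iw) eqseq_cons andbC; congr (nat_of_bool (_ && _)).
  by rewrite onthE (nth_map k).
have -> : i = ord_max by apply/val_inj/eqP; rewrite eqn_leq wi -ltnS ltn_ord.
by rewrite word_tup_mul_last drop_size.
Qed.

(** Back substitution along the path, starting from its last vertex. *)
Let word_tup_system w t N (X : 'I_d -> 'M[C]_N) (b : 'cV[C]_N)
    (Y : 'I_N -> 'M[C]_((size w).+1)) :
  (forall i, Y i = (b i 0)%:M + pencil_act X (word_tup w t) Y i) ->
  forall (a : 'I_(size w).+1) i, Y i a ord_max =
    t ^+ size (drop a w) * (wordmx X (drop a w) *m b) i 0.
Proof.
move=> YE a; move: {2}(size w - a)%N (leqnn (size w - a)) => m.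
elim: m a => [|m IHm] a am i.
  have -> : a = ord_max.
    by apply/val_inj => /=; move: am (ltn_ord a); lia.
  rewrite YE mxE /pencil_act summxE big1 => [|k _].
    by rewrite drop_size /= expr0 mul1r mul1mx addr0 mxE eqxx.
  by rewrite summxE big1 // => j _; rewrite mxE word_tup_mul_last mulr0.
have [aw|] := ltnP a (size w); last first.
  by move=> wa; apply: IHm; move: wa am; lia.
pose k0 := tnth (in_tuple w) (Ordinal aw).
rewrite (drop_nth k0 aw) YE mxE mxE -val_eqE /= (ltn_eqF aw) mulr0n add0r.
pose a' : 'I_(size w).+1 := Ordinal (aw : a.+1 < (size w).+1)%N.
rewrite /pencil_act summxE (bigD1 (nth k0 w a)) //= [X in _ + X]big1 => [|k kw].
  rewrite addr0 summxE -mulmxA mxE mulr_sumr; apply: eq_bigr => j _.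
  rewrite mxE (@word_tup_mul w t _ _ _ a a') // onthE (nth_map k0) // eqxx.
  by rewrite mulr1n (IHm a') /= ?exprS; [ring | lia].
rewrite summxE big1 // => j _; rewrite mxE (@word_tup_mul w t _ _ _ a a') //.
rewrite onthE (nth_map k0) // (inj_eq Some_inj) eq_sym (negbTE kw).
by rewrite mulr0n mul0r mulr0.
Qed.

Let word_tup_gram w t :
  \sum_k word_tup w t k *m (word_tup w t k)^t* =
  diag_mx (\row_(i < (size w).+1) (`|t| ^+ 2 *+ (i < size w)%N)).
Proof.
apply/matrixP => i i'; rewrite summxE !mxE.
have [iw|wi] := ltnP i (size w); last first.
  rewrite mulr0n mul0rn big1 // => k _.
  have -> : i = ord_max by apply/val_inj => /=; move: wi (ltn_ord i); lia.
  by rewrite word_tup_mul_last.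
pose i1 : 'I_(size w).+1 := Ordinal (iw : i.+1 < (size w).+1)%N.
pose k0 := tnth (in_tuple w) (Ordinal iw).
have wE k : (onth w i == Some k) = (k0 == k).
  by rewrite onthE (nth_map k0) // (inj_eq Some_inj) [k0 in RHS](tnth_nth k0).
rewrite (bigD1 k0) //= big1 => [|k k0k]; last first.
  by rewrite (@word_tup_mul w t k _ _ i i1) // wE eq_sym (negbTE k0k) mul0r.
rewrite addr0 (@word_tup_mul w t k0 _ _ i i1) // wE eqxx !mxE eqSS.
rewrite (_ : (i == i' :> nat) = (i == i')) //; case: eqP => [<-|_].
  by rewrite wE eqxx !mulr1n normCK.
by rewrite !mulr0n rmorph0 mulr0.
Qed.

Let word_tup_ball w (t : C) : `|t| < 1 -> row_ball (word_tup w t).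
Proof.
move=> t1 v v_neq0; rewrite word_tup_gram.
have -> : (v^t* *m (1%:M -
    diag_mx (\row_(i < (size w).+1) (`|t| ^+ 2 *+ (i < size w)%N))) *m v) 0 0
   = \sum_(i < (size w).+1) (1 - `|t| ^+ 2 *+ (i < size w)%N) * `|v i 0| ^+ 2.
  rewrite -mulmxA mulmxBl mul1mx mul_diag_mx mxE; apply: eq_bigr => i _.
  rewrite !mxE (normCK (v i 0)); set a := _ *+ _.
  by ring.
have pos i : 0 < 1 - `|t| ^+ 2 *+ (i < size w)%N.
  by case: (i < _)%N; rewrite ?mulr0n ?subr0 // mulr1n subr_gt0 expr_lt1.
have [i vi] : exists i, v i 0 != 0.
  apply/existsP; apply: contraT; rewrite negb_exists => /forallP v0.
  move: v_neq0; rewrite (_ : v = 0) ?eqxx //.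
  by apply/colP => i; rewrite mxE; apply/eqP/negPn.
rewrite (bigD1 i) //= ltr_wpDr //.
  by apply: sumr_ge0 => j _; rewrite mulr_ge0 ?exprn_ge0 // ltW.
by rewrite mulr_gt0 // exprn_gt0 // normr_gt0.
Qed.

Lemma word_psum_single (F : seq 'I_d -> C) w m :
  (forall v, v != w -> F v = 0) -> (size w < m)%N -> word_psum F m = F w.
Proof.
move=> F0 wm; rewrite /word_psum (bigD1 (Ordinal wm)) //= [X in _ + X]big1.
  rewrite addr0 (bigD1 (in_tuple w)) //= big1 ?addr0 // => v vw.
  by apply: F0; apply: contra vw => /eqP vw; apply/eqP/val_inj.
move=> k kw; rewrite big1 // => v _; apply: F0.
by apply: contra kw => /eqP vw; apply/eqP/val_inj; rewrite /= -vw size_tuple.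
Qed.

Lemma cvg_word_psum_single (F : seq 'I_d -> C) w :
  (forall v, v != w -> F v = 0) -> word_psum F @ \oo --> (F w : C^o).
Proof.
move=> F0; apply: cvg_near_cst; exists (size w).+1 => // m /= wm.
by rewrite (word_psum_single F0).
Qed.

(** Among [1/2, 1/3, ...] there are more candidates than roots. *)
Let small_nonroot (q : {poly C}) : q != 0 ->
  exists t : C, [/\ `|t| < 1, t != 0 & q.[t] != 0].
Proof.
move=> q_neq0; apply: contrapT => nex.
pose rs := [seq ((i.+2)%:R^-1 : C) | i <- iota 0 (size q)].
have rs_roots : all (root q) rs.
  apply/allP => _ /mapP[i _ ->]; apply: contraT => qi; case: nex.
  exists (i.+2)%:R^-1; split=> //; rewrite ?invr_eq0 ?pnatr_eq0 //.
  by rewrite normfV normr_nat invf_lt1 ?ltr0n // ltr1n.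
have rs_uniq : uniq rs.
  rewrite map_inj_uniq ?iota_uniq // => i j /invr_inj /eqP.
  by rewrite eqr_nat => /eqP[].
by have := max_poly_roots q_neq0 rs_roots rs_uniq; rewrite size_map size_iota ltnn.
Qed.

(** At the weighted path of [w], the corner entry of [b] is [t ^+ size w] times the coefficient by
    the Taylor series, and [t ^+ size w] times [c X^w beta] by the realization. *)
Lemma hcoef_realization (b : hinf R d) r s N (X : 'I_d -> 'M[C]_N) c beta :
  hinf_given_by b r -> nc_equiv r s -> ncdom s (fun=> 0 : 'M[C]_1) ->
  realizes s X c beta -> realizes_coef (hcoef b) X c beta.
Proof.
move=> [nondeg_r rb] rs s0 sX w.
pose P k : 'M[{poly C}]_((size w).+1) := 'X *: map_mx polyC (word_tup w 1 k).
have PE t : path_tup P t = word_tup w t.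
  apply/funext => k; apply/matrixP => i j.
  by rewrite !mxE /horner_eval hornerM hornerX hornerC mulrnAr mulr1.
(* Definedness at 0 passes from size 1 to the size of the path through scalar matrices. Hence [s] is
   defined at the path for all but finitely many [t], and one such [t] is nonzero and inside the
   ball. *)
have s0' : ncdom s (path_tup P 0).
  pose phi (A : 'M[C]_1) : 'M[C]_((size w).+1) := (A 0 0)%:M.
  have [] := @nceval_hom _ _ _ _ phi s (fun=> 0).
  - by move=> a; rewrite /phi mxE eqxx.
  - by move=> A B; rewrite /phi mxE raddfD.
  - by move=> A B; rewrite /phi mxE big_ord1 scalar_mxM.
  - exact: s0.
  move=> dom _; move: dom; congr (ncdom s _); rewrite PE; apply/funext => k.
  by apply/matrixP => i j; rewrite !mxE !mul0rn.
have [q [M [q0 qM]]] := nceval_path s0'.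
have [|t [t1 t_neq0 /qM[dom _]]] := @small_nonroot q.
  by apply: contra_neq q0 => ->; rewrite horner0.
rewrite PE in dom; have ball := @word_tup_ball w t t1.
have [s' [_ rs' dom' s'Z]] := rb _ _ ball.
have ss' : nc_equiv s s'.
  by apply: nc_equiv_trans nondeg_r _ rs' => n Z d1 d2; rewrite (rs n Z d2 d1).
have [Y [YE sY]] := sX _ _ dom.
have hvalE : hval b (word_tup w t) ord0 ord_max =
    t ^+ size w * (c *m wordmx X w *m beta) 0 0.
  rewrite -s'Z -ss' // sY summxE -mulmxA [in RHS]mxE mulr_sumr.
  by apply: eq_bigr => i _; rewrite mxE (word_tup_system YE) drop0 mulrCA.
pose F v : C := hcoef b v * mxpow (word_tup w t) v ord0 ord_max.
have /(cvg_lim (@norm_hausdorff _ _)) limF := @hval_taylor _ _ b _ _ ball ord0 ord_max.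
have /(cvg_lim (@norm_hausdorff _ _)) : word_psum F @ \oo --> (F w : C^o).
  apply: cvg_word_psum_single => v vw.
  by rewrite /F word_tup_pow drop0 eq_sym (negbTE vw) mulr0n mulr0.
rewrite limF hvalE /F word_tup_pow drop0 eqxx mulr1n mulrC.
by apply: mulIf; rewrite expf_neq0.
Qed.

End Taylor.

(** * Expressions defined at a prescribed point *)

Section ExpressionFromPencil.
Variables (R : realType) (d : nat).
Local Notation C := R[i].
Implicit Types (s : ncexpr R d).

Definition ncsum (I : Type) (r : seq I) (F : I -> ncexpr R d) : ncexpr R d :=
  foldr (fun i s => NCadd (F i) s) (NCconst d 0) r.

Definition ncsub s1 s2 := NCadd s1 (NCmul (NCconst d (-1)) s2).

Lemma nceval_sum (I : Type) (r : seq I) (F : I -> ncexpr R d) n (Z : mxtup R d n) :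
  nceval (ncsum r F) Z = \sum_(i <- r) nceval (F i) Z.
Proof.
by elim: r => [|i r IHr] /=; rewrite ?big_nil ?raddf0 // big_cons IHr.
Qed.

Lemma ncdom_sum (I : Type) (r : seq I) (F : I -> ncexpr R d) n (Z : mxtup R d n) :
  ncdom (ncsum r F) Z = all (fun i => ncdom (F i) Z) r.
Proof. by elim: r => //= i r ->. Qed.

Lemma nceval_sub s1 s2 n (Z : mxtup R d n) :
  nceval (ncsub s1 s2) Z = nceval s1 Z - nceval s2 Z.
Proof. by rewrite /= mul_scalar_mx scaleN1r. Qed.

Lemma ncdom_sub s1 s2 n (Z : mxtup R d n) :
  ncdom (ncsub s1 s2) Z = ncdom s1 Z && ncdom s2 Z.
Proof. by []. Qed.

(** At [Z0] the pivot is 1 and the Schur complement is again the identity, so elimination proceeds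
    without pivoting. At any other point, definedness of the result forces the pivots to be
    invertible. *)
Lemma gauss_elimination N (H : 'I_N -> 'I_N -> ncexpr R d)
    (v : 'I_N -> ncexpr R d) n (Z0 : mxtup R d n) :
  (forall i j, ncdom (H i j) Z0 /\ nceval (H i j) Z0 = (i == j)%:R%:M) ->
  (forall i, ncdom (v i) Z0) ->
  exists u : 'I_N -> ncexpr R d, (forall i, ncdom (u i) Z0) /\
    forall m (Z : mxtup R d m), (forall i, ncdom (u i) Z) ->
      forall i, \sum_j nceval (H i j) Z *m nceval (u j) Z = nceval (v i) Z.
Proof.
elim: N H v => [|N IHN] H v HZ vZ.
  by exists (fun=> NCconst d 0); split=> // m Z _ [].
pose q i := NCmul (H (lift ord0 i) ord0) (NCinv (H ord0 ord0)).
pose H' i j := ncsub (H (lift ord0 i) (lift ord0 j))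
  (NCmul (q i) (H ord0 (lift ord0 j))).
pose v' i := ncsub (v (lift ord0 i)) (NCmul (q i) (v ord0)).
have p1 : nceval (H ord0 ord0) Z0 = 1%:M by rewrite (HZ ord0 ord0).2.
have dH i j : ncdom (H i j) Z0 by case: (HZ i j).
have [i j|i|u' [du' u'E]] := IHN H' v'.
- rewrite ncdom_sub nceval_sub /= !dH p1 unitmx1 !(HZ _ _).2.
  by rewrite (inj_eq lift_inj) /= raddf0 !mul0mx subr0.
- by rewrite ncdom_sub /= !dH !vZ p1 unitmx1.
pose u0 := NCmul (NCinv (H ord0 ord0))
  (ncsub (v ord0) (ncsum (index_enum 'I_N)
    (fun j => NCmul (H ord0 (lift ord0 j)) (u' j)))).
exists (fun i => if unlift ord0 i is Some j then u' j else u0); split=> [i|m Z dZ i].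
  case: unliftP => [j _|_] //=; rewrite dH p1 unitmx1 vZ ncdom_sum /=.
  by apply/allP => j _ /=; rewrite dH du'.
have du0 : ncdom u0 Z by have := dZ ord0; rewrite unlift_none.
have du'Z j : ncdom (u' j) Z by have := dZ (lift ord0 j); rewrite liftK.
rewrite big_ord_recl unlift_none; under eq_bigr do rewrite liftK.
have u0E : nceval u0 Z = invmx (nceval (H ord0 ord0) Z) *m
    (nceval (v ord0) Z - \sum_j nceval (H ord0 (lift ord0 j)) Z *m nceval (u' j) Z).
  by rewrite [LHS]/= mul_scalar_mx scaleN1r nceval_sum.
have up : nceval (H ord0 ord0) Z \in unitmx.
  by move: du0 => /= /andP[/andP[]].
rewrite u0E; have [j ->|->] := unliftP ord0 i; last by rewrite mulKVmx // subrK.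
have := u'E m Z du'Z j; rewrite nceval_sub.
rewrite (eq_bigr (fun l => nceval (H (lift ord0 j) (lift ord0 l)) Z *m nceval (u' l) Z
   - nceval (q j) Z *m (nceval (H ord0 (lift ord0 l)) Z *m nceval (u' l) Z))) => [|l _].
  rewrite sumrB -mulmx_sumr => /(canRL (subrK _)) ->.
  rewrite mulmxA -[_ *m invmx _]/(nceval (q j) Z) mulmxBr.
  rewrite -[nceval (NCmul (q j) (v ord0)) Z]/(nceval (q j) Z *m nceval (v ord0) Z).
  by rewrite addrC -addrA [X in _ + X]addrCA subrr addr0 subrK.
by rewrite nceval_sub mulmxBl /= mulmxA.
Qed.

Lemma realization_expr N (X : 'I_d -> 'M[C]_N) c b n (Z0 : mxtup R d n) :
  (0 < n)%N -> 1%:M - pencil X Z0 \in unitmx ->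
  exists s, [/\ nc_nondeg s, ncdom s Z0 & realizes s X c b].
Proof.
move=> n0 uT.
pose M i j := ncsub (NCconst d (i == j)%:R)
  (ncsum (index_enum 'I_d) (fun k => NCmul (NCconst d (X k i j)) (NCvar R k))).
have dM i j m (Z : mxtup R d m) : ncdom (M i j) Z.
  by rewrite ncdom_sub ncdom_sum /=; apply/allP.
have ME m (Z : mxtup R d m) (Y : 'I_N -> 'M[C]_m) i :
    \sum_j nceval (M i j) Z *m Y j = Y i - pencil_act X Z Y i.
  rewrite /pencil_act exchange_big -[Y i in RHS](_ : \sum_j (i == j)%:R *: Y j = _).
    rewrite -sumrB; apply: eq_bigr => j _; rewrite nceval_sub nceval_sum /=.
    rewrite mulmxBl mul_scalar_mx mulmx_suml; congr (_ - _).
    by apply: eq_bigr => k _; rewrite mul_scalar_mx scalemxAl.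
  rewrite (bigD1 i) //= eqxx scale1r big1 ?addr0 // => j ji.
  by rewrite eq_sym (negbTE ji) scale0r.
pose everywhere s := forall m (Z : mxtup R d m), ncdom s Z.
(* Being values at [Z0] of everywhere defined expressions is stable under the pencil, so
   [pencil_solve] yields the inverse of [1 - pencil] in this form. *)
pose S (V : 'I_N -> 'M[C]_n) :=
  forall i, exists s, everywhere s /\ nceval s Z0 = V i.
have S_lin a Y Y' : S Y -> S Y' -> S (fun i => a *: Y i + Y' i).
  move=> SY SY' i; have [s [ds <-]] := SY i; have [s' [ds' <-]] := SY' i.
  exists (NCadd (NCmul (NCconst d a) s) s'); split; last by rewrite /= mul_scalar_mx.
  by move=> m Z; rewrite /= ds ds'.
have S_act Y : S Y -> S (pencil_act X Z0 Y).
  move=> /choice[F FY] i.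
  exists (ncsum (index_enum 'I_d) (fun k => ncsum (index_enum 'I_N) (fun j =>
    NCmul (NCconst d (X k i j)) (NCmul (NCvar R k) (F j))))); split.
    move=> m Z; rewrite ncdom_sum; apply/allP => k _; rewrite ncdom_sum.
    by apply/allP => j _ /=; case: (FY j) => ->.
  rewrite nceval_sum; apply: eq_bigr => k _; rewrite nceval_sum.
  by apply: eq_bigr => j _ /=; case: (FY j) => _ ->; rewrite mul_scalar_mx.
have /choice[Y YE] (l : 'I_N) : exists Y, S Y /\
    forall i, Y i = (i == l)%:R%:M + pencil_act X Z0 Y i.
  have [] := @pencil_solve _ _ _ _ X Z0 S (fun i => (i == l)%:R%:M) uT S_lin S_act.
    by move=> i; exists (NCconst d (i == l)%:R).
  by move=> Y SY YE; exists Y.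
have /choice[W WE] (l : 'I_N) : exists F : 'I_N -> ncexpr R d,
    forall i, everywhere (F i) /\ nceval (F i) Z0 = Y l i.
  by have [/choice[F FP] _] := YE l; exists F.
(* [W l] is the [l]-th block column of the inverse at [Z0], so the product [H] of [M] with it is the
   identity there. A solution [u] of the system [H] gives the state [y], the product of [W] with
   [u]. *)
pose H i l := ncsum (index_enum 'I_N) (fun j => NCmul (M i j) (W l j)).
have dH i l m (Z : mxtup R d m) : ncdom (H i l) Z.
  rewrite ncdom_sum; apply/allP => j _.
  by apply/andP; split; [exact: dM | case: (WE l j)].
have [i l|i|u [du uE]] := @gauss_elimination N H (fun i => NCconst d (b i 0)) n Z0.
- split; first exact: dH.
  rewrite nceval_sum (eq_bigr (fun j => nceval (M i j) Z0 *m Y l j)) => [|j _].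
    by rewrite ME (YE l).2 addrK.
  by rewrite -(WE l j).2.
- by [].
pose y i := ncsum (index_enum 'I_N) (fun l => NCmul (W l i) (u l)).
pose s := ncsum (index_enum 'I_N) (fun i => NCmul (NCconst d (c 0 i)) (y i)).
have ds : ncdom s Z0.
  rewrite ncdom_sum; apply/allP => i _ /=; rewrite ncdom_sum; apply/allP => l _ /=.
  by rewrite du; case: (WE l i) => ->.
exists s; split=> // [|m Z]; first by exists n, Z0.
rewrite ncdom_sum => /allP dsZ.
have dy i : ncdom (y i) Z by exact: dsZ (mem_index_enum i).
have du' l : ncdom (u l) Z.
  have := dy l; rewrite ncdom_sum => /allP/(_ l (mem_index_enum l)) /=.
  by case/andP.
exists (fun i => nceval (y i) Z); split=> [i|]; last first.
  by rewrite nceval_sum; apply: eq_bigr => i _; rewrite /= mul_scalar_mx.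
apply/eqP; rewrite -subr_eq; apply/eqP; rewrite -ME -[RHS](uE m Z du' i).
under [RHS]eq_bigr do rewrite nceval_sum mulmx_suml.
rewrite [RHS]exchange_big; apply: eq_bigr => j _.
rewrite nceval_sum mulmx_sumr; apply: eq_bigr => l _.
by rewrite /= mulmxA.
Qed.

End ExpressionFromPencil.

(** * The free Hardy space and the de Branges--Rovnyak inner product *)

(** The four terms have the shape handled by [l2_lin]; convergence of squared norms thereby gives
    that of inner products in [tends_ip]. *)
Lemma polarization (C : numClosedFieldType) (a b : C) :
  a^* * b = 4^-1 * (`|1 * a + b| ^+ 2 - `|-1 * b + a| ^+ 2
    - 'i * `|'i * b + a| ^+ 2 + 'i * `|- 'i * b + a| ^+ 2).
Proof.
have four : 4 != 0 :> C by rewrite pnatr_eq0.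
rewrite !normCK !(rmorphD, rmorphM, rmorphN, rmorph1) /= conjCi -[LHS](mulKf four).
congr (_ * _); move: (sqrCi C) a^* b^*; rewrite expr2 => i2 a' b'.
transitivity (2 * (a * b' + b * a') - 2 * ('i * 'i) * (b * a' - a * b')); last by ring.
by rewrite i2; ring.
Qed.

Section HardySpace.
Variables (R : realType) (d : nat).
Local Notation C := R[i].
Local Open Scope classical_set_scope.
Implicit Types (f g h : fps R d) (u : nat -> C).

Lemma complex_arch (x : C) : exists k : nat, `|x| <= k%:R.
Proof.
exists (Num.truncn (complex.Re `|x|)).+1.
have xE : `|x| = (complex.Re `|x|)%:C%C by apply/esym/RRe_real/normr_real.
rewrite xE -(rmorph_nat (real_complex R)) lecR.
by apply/ltW/truncnS_gt.
Qed.

Lemma cvg_null_seq u (l : C) :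
  ((u : nat -> C^o) @ \oo --> (l : C^o)) <-> null_seq (fun m => l - u m).
Proof.
split=> [/cvgrPdist_lt ul e e0|ul].
  by have [N _ uN] := ul _ e0; exists N => m /uN /ltW.
apply/cvgrPdist_lt => e e0; have e2 : 0 < e / 2 by rewrite divr_gt0.
have [N uN] := ul _ e2; exists N => // m /= /uN /le_lt_trans; apply.
by rewrite ltr_pdivrMr // mulr_natr mulr2n ltrDl.
Qed.

Let psum (F : seq 'I_d -> C) : nat -> C := word_psum F.

Let psumS F m : psum F m.+1 = psum F m + wsum m F.
Proof. by rewrite /psum /word_psum big_ord_recr. Qed.

Let sqr f := psum (fun w => `|f w| ^+ 2).

Let sqr_homo f : {homo sqr f : m p / (m <= p)%N >-> m <= p}.
Proof.
apply: homo_leq => [//|? ? ?|m]; first exact: le_trans.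
by rewrite /sqr psumS lerDl; apply: wsum_ge0 => w; rewrite exprn_ge0.
Qed.

Let sqr_ge0 f m : 0 <= sqr f m.
Proof.
rewrite (le_trans _ (sqr_homo f (leq0n m))) //.
by rewrite /sqr /psum /word_psum big_ord0.
Qed.

Let l2_tends f : l2 f -> exists l, null_seq (fun m => l - sqr f m).
Proof. by move=> /cvg_ex[l /cvg_null_seq]; exists l. Qed.

Lemma l2_level_null f : l2 f -> level_null f.
Proof.
move=> /l2_tends[l lf].
apply: eq_null_seq (null_seqD (null_seqZ (-1) (null_seq_shift 1 lf)) lf) => m.
by rewrite addn1 /sqr psumS; ring.
Qed.

(** Monotone convergence in [R], transported to [R[i]] by real parts: the partial sums are
    nonnegative, hence real. *)
Let l2P f : l2 f <-> exists M, forall m, sqr f m <= M.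
Proof.
split=> [/l2_tends[l lf]|[M fM]].
  have [N fN] := lf 1 ltr01; exists (`|l| + 1) => m.
  rewrite (le_trans (sqr_homo f (leq_maxl m N))) //.
  have := fN _ (leq_maxr m N); rewrite distrC => /(lerD (lexx `|l|)); apply: le_trans.
  rewrite -[leLHS]ger0_norm // -{1}[sqr f _](addrNK l) addrC ler_normD //.
pose r m : R := complex.Re (sqr f m).
have rE m : sqr f m = (r m)%:C%C by apply/esym/RRe_real; rewrite ger0_real.
have ME : M = (complex.Re M)%:C%C.
  by apply/esym/RRe_real; rewrite ger0_real // (le_trans _ (fM 0)).
have : cvgn r.
  apply: nondecreasing_is_cvgn.
    by move=> m p mp; rewrite -lecR -!rE sqr_homo.
  by exists (complex.Re M) => _ [m _ <-]; rewrite -lecR -rE -ME.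
move=> /cvg_ex[l /cvgrPdist_lt rl]; apply/cvg_ex; exists (l%:C%C : C^o).
apply/cvg_null_seq => e e0.
have eE : e = (complex.Re e)%:C%C by apply/esym/RRe_real/gtr0_real.
have [|N _ rN] := rl (complex.Re e); first by rewrite -ltcR -eE.
exists N => m /rN; rewrite -[word_psum _ m]/(sqr f m) rE -rmorphB /= => lt.
by rewrite -[X in X <= _]/(Num.norm _) normc_def /= expr0n addr0 sqrtr_sqr eE lecR ltW.
Qed.

Lemma l2_lin (a : C) f g : l2 f -> l2 g -> l2 (a *: f + g).
Proof.
move=> /l2P[M fM] /l2P[M' gM']; apply/l2P.
exists (2 * (`|a| ^+ 2 * M + M')) => m.
apply: (@le_trans _ _ (2 * (`|a| ^+ 2 * sqr f m + sqr g m))); last first.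
  rewrite ler_pM2l // lerD // ler_wpM2l ?exprn_ge0 //.
rewrite /sqr /psum /word_psum !mulr_sumr -big_split mulr_sumr.
apply: ler_sum => k _; rewrite mulr_sumr -big_split mulr_sumr.
apply: ler_sum => w _ /=; rewrite -exprMn -normrM.
exact: sqr_normD_le.
Qed.

Lemma l2_0 : l2 (0 : fps R d).
Proof.
apply/l2P; exists 0 => m; rewrite /sqr /psum /word_psum big1 // => k _.
by rewrite big1 // => w _; rewrite normr0 expr0n.
Qed.

Lemma l2_scale (a : C) f : l2 f -> l2 (a *: f).
Proof. by move=> f2; rewrite -[_ *: _]addr0; apply: l2_lin l2_0. Qed.

Lemma l2_mono w : l2 (mono R d w).
Proof.
apply/cvg_ex; eexists; apply: (@cvg_word_psum_single _ _ _ w) => v vw.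
by rewrite /mono (negbTE vw) normr0 expr0n.
Qed.

Let pairing f g := psum (fun w => (f w)^* * g w).

Lemma tends_ip f g : l2 f -> l2 g -> null_seq (fun m => ip f g - pairing f g m).
Proof.
move=> f2 g2.
suff [l lE] : exists l, null_seq (fun m => l - pairing f g m).
  have /cvg_null_seq/(cvg_lim (@norm_hausdorff _ _)) lim := lE.
  by rewrite (_ : ip f g = l).
have [l1 E1] := l2_tends (l2_lin (a := 1) f2 g2).
have [l2 E2] := l2_tends (l2_lin (a := -1) g2 f2).
have [l3 E3] := l2_tends (l2_lin (a := 'i) g2 f2).
have [l4 E4] := l2_tends (l2_lin (a := - 'i) g2 f2).
exists (4^-1 * (l1 - l2 - 'i * l3 + 'i * l4)).
have E := null_seqD (null_seqD E1 (null_seqZ (-1) E2))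
  (null_seqD (null_seqZ (- 'i) E3) (null_seqZ 'i E4)).
apply: eq_null_seq (null_seqZ (4^-1) E) => m.
have -> : pairing f g m = 4^-1 * (sqr (1 *: f + g) m - sqr (-1 *: g + f) m
    - 'i * sqr ('i *: g + f) m + 'i * sqr (- 'i *: g + f) m); last by ring.
rewrite /pairing /sqr /psum /word_psum !mulr_sumr -!sumrB -big_split mulr_sumr.
apply: eq_bigr => k _; rewrite !mulr_sumr -!sumrB -big_split mulr_sumr.
by apply: eq_bigr => w _; apply: polarization.
Qed.

Let ip_unique f g l : l2 f -> l2 g ->
  null_seq (fun m => l - pairing f g m) -> ip f g = l.
Proof.
move=> f2 g2 lfg; apply/eqP; rewrite -subr_eq0; apply/eqP.
apply: (null_seq_cst (u := fun=> `|ip f g - l|)) => // e e0.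
have [N lN] := null_seqD (tends_ip f2 g2) (null_seqZ (-1) lfg) e0.
exists N => m /lN; rewrite normr_id; congr (`|_| <= e); ring.
Qed.

Lemma ip_lin (a : C) f g h : l2 f -> l2 g -> l2 h ->
  ip f (a *: g + h) = a * ip f g + ip f h.
Proof.
move=> f2 g2 h2; apply: (ip_unique f2 (l2_lin g2 h2)).
apply: eq_null_seq (null_seqD (null_seqZ a (tends_ip f2 g2)) (tends_ip f2 h2)) => m.
have -> : pairing f (a *: g + h) m = a * pairing f g m + pairing f h m; last by ring.
rewrite /pairing /psum /word_psum mulr_sumr -big_split; apply: eq_bigr => k _.
rewrite mulr_sumr -big_split; apply: eq_bigr => w _ /=.
by rewrite -[(a *: g + h) w]/(a * g w + h w) mulrDr mulrCA.
Qed.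

Lemma ip_conj f g : l2 f -> l2 g -> ip g f = (ip f g)^*.
Proof.
move=> f2 g2; apply: (ip_unique g2 f2) => e /(tends_ip f2 g2)[N fgN].
exists N => m /fgN; rewrite -norm_conjC rmorphB; congr (`|_ - _| <= e).
rewrite /pairing /psum /word_psum rmorph_sum; apply: eq_bigr => k _.
rewrite rmorph_sum; apply: eq_bigr => w _ /=.
by rewrite rmorphM /= conjCK mulrC.
Qed.

Lemma ip_eq0 f : l2 f -> ip f f = 0 -> f = 0.
Proof.
move=> f2 ff; apply/funext => w.
have null : null_seq (sqr f).
  apply: eq_null_seq (null_seqZ (-1) (tends_ip f2 f2)) => m.
  rewrite ff mulN1r sub0r opprK; apply: eq_bigr => k _; apply: eq_bigr => v _.
  by rewrite normCK mulrC.
suff /eqP : `|f w| ^+ 2 = 0 by rewrite expf_eq0 normr_eq0 => /eqP.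
apply: null_seq_cst (null_seq_shift (size w).+1 null) _ => m.
rewrite ger0_norm ?exprn_ge0 // (le_trans _ (sqr_homo f (leq_addl m _))) //.
rewrite /sqr psumS ler_wpDl ?sqr_ge0 // /wsum (bigD1 (in_tuple w)) //= lerDl.
by apply: sumr_ge0 => v _; rewrite exprn_ge0.
Qed.

Lemma ip_monol w h : ip (mono R d w) h = h w.
Proof.
pose F v : C := (mono R d w v)^* * h v.
have /(cvg_lim (@norm_hausdorff _ _)) limF : word_psum F @ \oo --> (F w : C^o).
  apply: cvg_word_psum_single => v vw.
  by rewrite /F /mono (negbTE vw) rmorph0 mul0r.
by rewrite [LHS]limF /F /mono eqxx rmorph1 mul1r.
Qed.

Lemma ip_monor w h : ip h (mono R d w) = (h w)^*.
Proof.
pose F v : C := (h v)^* * mono R d w v.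
have /(cvg_lim (@norm_hausdorff _ _)) limF : word_psum F @ \oo --> (F w : C^o).
  by apply: cvg_word_psum_single => v vw; rewrite /F /mono (negbTE vw) mulr0.
by rewrite [LHS]limF /F /mono eqxx mulr1.
Qed.

Lemma l2_sum n (a : 'I_n -> C) (F : 'I_n -> fps R d) :
  (forall i, l2 (F i)) -> l2 (\sum_i a i *: F i).
Proof.
move=> F2; apply: (big_ind (@l2 R d)) => [|f g f2 g2|i _].
- exact: l2_0.
- by rewrite -[f]scale1r; apply: l2_lin.
exact: l2_scale.
Qed.

Lemma ip0r f : l2 f -> ip f 0 = 0.
Proof.
move=> f2; have := ip_lin 1 f2 l2_0 l2_0.
by rewrite scaler0 addr0 mul1r => /eqP; rewrite eq_sym -subr_eq0 addrK => /eqP.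
Qed.

Lemma ip_sumr n f (a : 'I_n -> C) (F : 'I_n -> fps R d) :
  l2 f -> (forall i, l2 (F i)) ->
  ip f (\sum_i a i *: F i) = \sum_i a i * ip f (F i).
Proof.
move=> f2; elim: n a F => [|n IHn] a F F2.
  by rewrite !big_ord0 ip0r.
rewrite !big_ord_recl ip_lin; last 3 first.
- exact: f2.
- exact: F2.
- by apply: l2_sum => i; apply: F2.
congr (_ + _); apply: IHn => i; exact: F2.
Qed.

Lemma ip_suml n f (a : 'I_n -> C) (F : 'I_n -> fps R d) :
  l2 f -> (forall i, l2 (F i)) ->
  ip (\sum_i a i *: F i) f = \sum_i (a i)^* * ip (F i) f.
Proof.
move=> f2 F2; rewrite (ip_conj f2 (@l2_sum _ a F F2)).
rewrite (@ip_sumr _ f a F f2 F2) rmorph_sum.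
by apply: eq_bigr => i _; rewrite rmorphM (ip_conj f2 (F2 i)).
Qed.

End HardySpace.

(** * Lifts through [D] and the range inner product *)

Section BranchRovnyak.
Variables (R : realType) (d : nat) (D : fop R d).
Local Notation C := R[i].
Local Open Scope classical_set_scope.
Implicit Types (f g h : fps R d).
Hypothesis D_lin : forall (a : C) f g, l2 f -> l2 g ->
  D (a *: f + g) = a *: D f + D g.

Definition is_lift h f :=
  [/\ l2 f, forall k, l2 k -> D k = 0 -> ip k f = 0 & D f = h].

Lemma is_lift_lin (a : C) h h' f f' :
  is_lift h f -> is_lift h' f' -> is_lift (a *: h + h') (a *: f + f').
Proof.
move=> [f2 fk <-] [f2' fk' <-]; split; first exact: l2_lin.
  by move=> k k2 k0; rewrite ip_lin // fk // fk' // mulr0 addr0.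
exact: D_lin.
Qed.

Lemma is_lift0 : is_lift 0 0.
Proof.
split; [exact: l2_0 | by move=> k k2 _; apply: ip0r |].
have := D_lin (-1) (@l2_0 R d) (@l2_0 R d).
by rewrite scaler0 addr0 scaleN1r addNr.
Qed.

Lemma is_lift_unique h f f' : is_lift h f -> is_lift h f' -> f = f'.
Proof.
move=> [f2 fk fh] [f2' fk' fh']; pose k := (-1) *: f' + f.
have k2 : l2 k := l2_lin f2' f2.
have Dk : D k = 0 by rewrite /k D_lin // fh fh' scaleN1r addNr.
have : k = 0.
  apply: ip_eq0 => //; rewrite {2}/k ip_lin // fk // fk' //.
  by rewrite mulr0 addr0.
by rewrite /k scaleN1r addrC => /eqP; rewrite subr_eq0 => /eqP.
Qed.

Lemma dbr_liftE h f : is_lift h f -> dbr_lift D h = f.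
Proof.
move=> hf; apply: xget_unique => [|g hg]; first exact: hf.
exact: is_lift_unique hg hf.
Qed.

Lemma dbr_ipE h f g k : is_lift h f -> is_lift g k -> dbr_ip D h g = ip f k.
Proof. by move=> hf gk; rewrite /dbr_ip (dbr_liftE hf) (dbr_liftE gk). Qed.

(* [dbr_lift] is 0 on elements without a lift, so these have norm 0. *)
Lemma dbr_lift_exists h : dbr_ip D h h <> 0 -> exists f, is_lift h f.
Proof.
move=> hh; apply: contrapT => nex; apply: hh.
rewrite /dbr_ip /dbr_lift xgetPN; first by rewrite ip0r //; exact: l2_0.
by move=> f hf; apply: nex; exists f.
Qed.

Lemma is_lift_sum n (a : 'I_n -> C) (h f : 'I_n -> fps R d) :
  (forall i, is_lift (h i) (f i)) ->
  is_lift (\sum_i a i *: h i) (\sum_i a i *: f i).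
Proof.
move=> hf; apply: (big_ind2 is_lift) => [|h1 f1 h2 f2 H1 H2|i _].
- exact: is_lift0.
- by rewrite -[h1]scale1r -[f1]scale1r; apply: is_lift_lin.
by rewrite -[_ *: h i]addr0 -[_ *: f i]addr0; apply: is_lift_lin is_lift0.
Qed.

Lemma dbr_ip_sum n (a b : 'I_n -> C) (e f : 'I_n -> fps R d) :
  (forall i, is_lift (e i) (f i)) ->
  (forall i j, dbr_ip D (e i) (e j) = (i == j)%:R) ->
  dbr_ip D (\sum_i a i *: e i) (\sum_i b i *: e i) = \sum_i (a i)^* * b i.
Proof.
move=> ef onb; rewrite (dbr_ipE (is_lift_sum a ef) (is_lift_sum b ef)).
have f2 i : l2 (f i) by case: (ef i).
rewrite (ip_suml a (l2_sum f2) f2); apply: eq_bigr => i _; congr (_ * _).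
rewrite (ip_sumr b (f2 i) f2) (bigD1 i) //= big1 ?addr0 => [|j ji].
  by rewrite -(dbr_ipE (ef i) (ef i)) onb eqxx mulr1.
by rewrite -(dbr_ipE (ef i) (ef j)) onb eq_sym (negbTE ji) mulr0.
Qed.

End BranchRovnyak.

(** * Shifts, multipliers and the defect operator on monomials *)

Section Operators.
Variables (R : realType) (d : nat).
Local Notation C := R[i].
Local Open Scope classical_set_scope.
Implicit Types (f g h : fps R d) (b : hinf R d).

Lemma adj_shiftL k h : adj (shiftL R d k) h = fun w => h (k :: w).
Proof.
apply/funext => w; rewrite /adj (_ : shiftL R d k _ = mono R d (k :: w)).
  by rewrite ip_monol.
apply/funext => -[//|i v]; rewrite /shiftL /mono eqseq_cons.
by case: eqP => //= _.
Qed.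

Lemma adj_mono (T : fop R d) w v : adj T (mono R d w) v = (T (mono R d v) w)^*.
Proof. exact: ip_monor. Qed.

Lemma multR_mono0 g (a : C) : multR g (a *: mono R d [::]) = a *: Ut g.
Proof.
apply/funext => w; rewrite /multR /Ut /multL /fps_mul big_ord_recr /=.
rewrite take_size drop_size big1 => [|i _].
  by rewrite add0r -[RHS]/(a * g (rev w)) mulrC -[X in X * _ = _]/(a * 1) mulr1.
rewrite -[X in _ * X]/(a * (rev (drop i (rev w)) == [::])%:R).
have -> : (rev (drop i (rev w)) == [::]) = false.
  by rewrite -size_eq0 [size (rev (drop _ _))]size_rev size_drop subn_eq0 leqNgt ltn_ord.
by rewrite !mulr0.
Qed.

(** As [v] is nonempty, only values of [g] on words shorter than [w] contribute. *)
Lemma multR_mono_low g v w : v != [::] ->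
  (forall u, (size u < size w)%N -> g u = 0) -> multR g (mono R d v) w = 0.
Proof.
move=> v0 g0; rewrite /multR /Ut /multL /fps_mul big_ord_recr /= big1 => [|i _].
  by rewrite add0r drop_size /mono eq_sym (negbTE v0) mulr0.
have iw : (i < size w)%N by rewrite -(size_rev w) ltn_ord.
by rewrite g0 ?mul0r // size_take_min (leq_ltn_trans (geq_minl _ _)).
Qed.

Lemma adj_multR_low g w :
  (forall u, (size u < size w)%N -> g u = 0) ->
  adj (multR g) (mono R d w) = (Ut g w)^* *: mono R d [::].
Proof.
move=> g0; apply/funext => v; rewrite adj_mono -[RHS]/((Ut g w)^* * (v == [::])%:R).
case: eqP => [->|/eqP v0]; last by rewrite multR_mono_low // rmorph0 mulr0.
by rewrite -[mono R d _]scale1r multR_mono0 scale1r mulr1.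
Qed.

(** Used at [[::]], where the condition is vacuous, and at a word of minimal length in the support
    of [bt b]. *)
Lemma defect_low b w :
  (forall u, (size u < size w)%N -> hcoef b u = 0) ->
  defect b (mono R d w) = mono R d w - (bt b w)^* *: bt b.
Proof. by move=> b0; rewrite /defect adj_multR_low // multR_mono0. Qed.

(* If [w] has minimal length in the support of [b^t], applying the bounded
   operator [D D] to [z^w] exhibits a nonzero multiple of [b^t] in [l2]. *)
Lemma l2_bt D b : is_pos_sqrt D (defect b) -> l2 (bt b).
Proof.
move=> [[D_l2 _ _] _ DD].
have [b0|b_neq0] := pselect (forall w, bt b w = 0).
  by rewrite (_ : bt b = 0); [exact: l2_0 | apply/funext => w; rewrite b0].
have exm : exists m, `[< exists2 w, size w = m & bt b w <> 0 >].
  move: b_neq0 => /existsNP[w bw]; exists (size w).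
  by apply/asboolP; exists w.
case: (ex_minnP exm) => m /asboolP[w wm bw] minm.
have low u : (size u < size w)%N -> hcoef b u = 0.
  move=> uw; apply: contrapT => bu; have := minm (size u).
  rewrite leqNgt -wm uw => /(_ _)/notF; apply; apply/asboolP.
  by exists (rev u); rewrite ?size_rev // /bt /Ut revK.
have := D_l2 _ (D_l2 _ (@l2_mono R d w)).
rewrite (DD _ (@l2_mono R d w)) (defect_low low).
move=> /(l2_lin (a := -1))/(_ (@l2_mono R d w)).
rewrite scaleN1r opprB subrK => /(@l2_scale _ _ ((bt b w)^*)^-1).
by rewrite scalerA mulVf ?scale1r // conjC_eq0; apply/eqP.
Qed.

Lemma row_ball0 : row_ball (fun _ : 'I_d => (0 : 'M[C]_1)).
Proof.
move=> v v0; rewrite big1 => [|k _]; last by rewrite mul0mx.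
rewrite subr0 mulmx1 mxE big_ord1 !mxE mulrC -normCK exprn_gt0 // normr_gt0.
by apply: contra v0 => /eqP v00; apply/eqP/matrixP => i j; rewrite !ord1 v00 mxE.
Qed.

Lemma hcoef_nil b : hval b (fun=> (0 : 'M[C]_1)) = 0 -> hcoef b [::] = 0.
Proof.
move=> b0; pose Z : mxtup R d 1 := fun=> 0.
pose F v : C := hcoef b v * mxpow Z v 0 0.
have /(cvg_lim (@norm_hausdorff _ _)) limF := @hval_taylor _ _ b _ _ row_ball0 0 0.
have /(cvg_lim (@norm_hausdorff _ _)) : word_psum F @ \oo --> (F [::] : C^o).
  by apply: cvg_word_psum_single => -[|k v] // _; rewrite /F /= mul0mx mxE mulr0.
by rewrite limF b0 /F /= !mxE eqxx mulr1.
Qed.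

End Operators.

(** * The matrices of [T(zeta)_k^*] on [K] *)

Section Compression.
Variables (R : realType) (d : nat) (b : hinf R d) (D : fop R d) (zeta : R[i]).
Variables (K : set (fps R d)) (n : nat) (e : 'I_n -> fps R d).
Local Notation C := R[i].
Local Open Scope classical_set_scope.
Hypothesis D_sqrt : is_pos_sqrt D (defect b).
Hypothesis b0 : hcoef b [::] = 0.
Hypothesis K_inv : Tadj_invariant D b zeta K.
Hypothesis K_iso : Tadj_column_isometric D b zeta K.
Hypothesis e_onb : is_onb D K e.

Let D_lin (a : C) f g : l2 f -> l2 g -> D (a *: f + g) = a *: D f + D g.
Proof. by case: D_sqrt => -[_ lin _] _ _; apply: lin. Qed.

Let e_lift : exists f : 'I_n -> fps R d, forall j, is_lift D (e j) (f j).
Proof.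
suff /choice[f ef] j : exists f, is_lift D (e j) f by exists f.
apply: dbr_lift_exists; case: e_onb => _ ej _.
by rewrite ej eqxx; apply/eqP; rewrite oner_eq0.
Qed.

(** As [b] vanishes at 0, the defect operator, which is the square of [D], fixes 1. This makes 1 the
    evaluation vector at the origin in [dbr_ip_one]. *)
Let one_lift : is_lift D (mono R d [::]) (D (mono R d [::])).
Proof.
case: D_sqrt => -[D_l2 _ _] [D_sym _] DD.
have one2 := @l2_mono R d [::].
split; first exact: D_l2.
  move=> k k2 k0; rewrite -(D_sym _ _ k2 one2) k0 (ip_conj one2 (@l2_0 R d)).
  by rewrite ip0r // rmorph0.
rewrite (DD _ one2) (defect_low (w := [::])) //.
by rewrite /bt /Ut b0 rmorph0 scale0r subr0.
Qed.

Let dbr_ip_one h f : is_lift D h f -> dbr_ip D (mono R d [::]) h = h [::].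
Proof.
move=> hf; rewrite (dbr_ipE D_lin one_lift hf).
case: hf D_sqrt => f2 _ <- [_ [D_sym _] _].
by rewrite (D_sym _ _ (@l2_mono R d [::]) f2) ip_monol.
Qed.

Let TadjE k h f : is_lift D h f ->
  Tadj D b zeta k h = fun w => h (k :: w) + zeta^* * h [::] * bt b (k :: w).
Proof.
by move=> hf; rewrite /Tadj !adj_shiftL (dbr_ip_one hf); apply/funext.
Qed.

(** The matrix of [T(zeta)_k^*] itself. [Amx] is its conjugate transpose, so that the transpose of
    [Amx] is the entrywise conjugate. *)
Definition compression k : 'M[C]_n :=
  \matrix_(i, j) dbr_ip D (e i) (Tadj D b zeta k (e j)).

Let comb (y : 'cV[C]_n) : fps R d := \sum_j y j 0 *: e j.

Let dbr_comb y z : dbr_ip D (comb y) (comb z) = \sum_j (y j 0)^* * z j 0.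
Proof.
have [f ef] := e_lift; case: e_onb => _ ee _.
exact: (dbr_ip_sum D_lin (fun j => y j 0) (fun j => z j 0) ef ee).
Qed.

Let comb_delta i : comb (delta_mx i 0) = e i.
Proof.
rewrite /comb (bigD1 i) //= mxE !eqxx scale1r big1 ?addr0 // => j ji.
by rewrite mxE (negbTE ji) scale0r.
Qed.

Let comb_lift y : exists f, is_lift D (comb y) f.
Proof.
have [f ef] := e_lift; exists (\sum_j y j 0 *: f j).
exact: is_lift_sum.
Qed.

Lemma Tadj_onb k j :
  Tadj D b zeta k (e j) = \sum_i compression k i j *: e i.
Proof.
case: e_onb => Ke ee Kspan; have [c cE] := Kspan _ (K_inv k (Ke j)).
rewrite {1}cE; apply: eq_bigr => i _; congr (_ *: _).
rewrite mxE cE -(comb_delta i) -[X in dbr_ip D _ X](_ : comb (\col_i c i) = _).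
  rewrite dbr_comb (bigD1 i) //= !mxE !eqxx rmorph1 mul1r big1 ?addr0 // => l li.
  by rewrite [delta_mx _ _ _ _]mxE (negbTE li) rmorph0 mul0r.
by apply: eq_bigr => l _; rewrite mxE.
Qed.

Let Tadj_comb k y : Tadj D b zeta k (comb y) = comb (compression k *m y).
Proof.
have [f ef] := e_lift; have [fy yf] := comb_lift y.
rewrite (TadjE k yf); apply/funext => w.
have combE z v : comb z v = \sum_j z j 0 * e j v by rewrite /comb fct_sumE.
transitivity (\sum_j y j 0 * Tadj D b zeta k (e j) w).
  rewrite !combE mulr_sumr mulr_suml -big_split; apply: eq_bigr => j _ /=.
  by rewrite (TadjE k (ef j)); ring.
transitivity (\sum_j \sum_i compression k i j * y j 0 * e i w).
  apply: eq_bigr => j _; rewrite Tadj_onb fct_sumE mulr_sumr.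
  by apply: eq_bigr => i _; rewrite -[X in _ * X]/(_ * e i w) mulrA [y j 0 * _]mulrC.
rewrite exchange_big combE; apply: eq_bigr => i _ /=.
by rewrite mxE mulr_suml.
Qed.

(* Column isometry is applied along the orbits of the basis vectors, which
   stay in [K]. *)
Lemma compression_word_isometric : word_isometric compression.
Proof.
have K_orbit w j : K (comb (wordmx compression w *m delta_mx j 0)).
  elim: w => [|k w IHw] /=; first by rewrite mul1mx comb_delta; case: e_onb.
  by rewrite -mulmxA -Tadj_comb; apply: K_inv.
have iso w j : \sum_k \sum_i `|wordmx compression (k :: w) i j| ^+ 2 =
    \sum_i `|wordmx compression w i j| ^+ 2.
  have colE v : \sum_i `|wordmx compression v i j| ^+ 2 =
      dbr_ip D (comb (wordmx compression v *m delta_mx j 0))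
        (comb (wordmx compression v *m delta_mx j 0)).
    by rewrite dbr_comb -colE; apply: eq_bigr => i _; rewrite !mxE normCK mulrC.
  rewrite colE -(K_iso (K_orbit w j)); apply: eq_bigr => k _.
  by rewrite colE Tadj_comb mulmxA.
elim=> [|m IHm]; first by rewrite wsum0 fro_scalar1.
rewrite wsumS -wsum_sum -[RHS]IHm; apply: eq_wsum => w _.
rewrite /fro; under eq_bigr do rewrite exchange_big.
rewrite exchange_big [RHS]exchange_big /=; apply: eq_bigr => j _.
exact: iso.
Qed.

Lemma Amx_tr_compression :
  (fun k => (Amx D b zeta e k)^T) = conj_tup compression.
Proof.
have [f ef] := e_lift; apply/funext => k; apply/matrixP => i j; rewrite !mxE.
have Tf := is_lift_sum D_lin (fun i => compression k i j) ef.
rewrite Tadj_onb (dbr_ipE D_lin Tf (ef i)) (dbr_ipE D_lin (ef i) Tf).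
case: (ef i) Tf => fi2 _ _ [T2 _ _].
exact: ip_conj fi2 T2.
Qed.

Lemma onb_cons j k w : e j (k :: w) =
  \sum_i compression k i j * e i w - zeta^* * e j [::] * bt b (k :: w).
Proof.
have [f ef] := e_lift; have := Tadj_onb k j; rewrite (TadjE k (ef j)).
by move=> /(congr1 (fun h => h w)); rewrite fct_sumE => <-; rewrite addrK.
Qed.

Lemma onb_l2 j : l2 (e j).
Proof.
case: D_sqrt => -[D_l2 _ _] _ _; have [f ef] := e_lift.
by case: (ef j) => f2 _ <-; apply: D_l2.
Qed.

Lemma onb_free (y : 'cV[C]_n) :
  (forall w, \sum_j e j w * y j 0 = 0) -> y = 0.
Proof.
move=> ey; have y0 : comb y = comb 0.
  apply/funext => w; rewrite /comb !fct_sumE.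
  transitivity (\sum_j e j w * y j 0); first by apply: eq_bigr => j _; rewrite mulrC.
  by rewrite ey big1 // => j _; rewrite mxE scale0r.
apply/colP => i; have := dbr_comb (delta_mx i 0) y; rewrite y0 dbr_comb.
have deltaE (z : 'cV[C]_n) :
    \sum_j ((delta_mx i 0 : 'cV[C]_n) j 0)^* * z j 0 = z i 0 :> C.
  rewrite (bigD1 i) //= mxE !eqxx rmorph1 mul1r big1 ?addr0 // => j ji.
  by rewrite [delta_mx _ _ _ _]mxE (negbTE ji) rmorph0 mul0r.
by rewrite !deltaE => ->.
Qed.

End Compression.

Local Open Scope classical_set_scope.

Theorem proposition5 (R : realType) (d : nat) (b : hinf R d) (r : ncexpr R d)
    (D : fop R d) (zeta : R[i]) (K : set (fps R d)) :
  hinf_ball1 b ->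
  hinf_given_by b r ->
  hval b (fun _ : 'I_d => (0 : 'M[R[i]]_1)) = 0 ->
  is_pos_sqrt D (defect b) ->
  `|zeta| = 1 ->
  subspace K ->
  (exists2 h, K h & h <> 0) ->
  K `<=` dbr_M D b ->
  Tadj_invariant D b zeta K ->
  Tadj_column_isometric D b zeta K ->
  forall (n : nat) (e : 'I_n -> fps R d), is_onb D K e ->
  exists B : 'M[R[i]]_n,
    ncrat_value r (fun k => (Amx D b zeta e k)^T) B /\ eigenvalue B zeta.
Proof.
move=> _ br b0 D_sqrt zeta1 _ [h Kh h_neq0] _ K_inv K_iso n e e_onb.
have n_gt0 : (0 < n)%N.
  case: n e e_onb => // e [_ _ /(_ _ Kh)[c]].
  by rewrite big_ord0 => h0; case: h_neq0.
have hb0 := hcoef_nil b0.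
rewrite (Amx_tr_compression D_sqrt K_inv e_onb).
set A := compression b D zeta e.
have isoA : word_isometric A :=
  compression_word_isometric D_sqrt hb0 K_inv K_iso e_onb.
have bt_null := l2_level_null (l2_bt D_sqrt).
have hb_null : level_null (hcoef b).
  by apply: eq_level_null (level_null_rev bt_null) => w; rewrite /bt /Ut revK.
(* [r] may be undefined at 0; the value of [b] there comes with an equivalent [s0] that is
   defined. *)
have [s0 [nondeg0 rs0 dom0 _]] := br.2 _ _ (@row_ball0 R d).
have [N [X [c [beta s0X]]]] := ncexpr_realization dom0.
have hX := hcoef_realization br rs0 dom0 s0X.
have [p [Y [c' [beta' [hY Y_null]]]]] := null_realization hX hb_null.
have [s [nondeg doms sY]] :=
  realization_expr c' beta' n_gt0 (contractive_pencil_unit Y_null isoA).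
exists (nceval s (conj_tup A)); split.
  exists s; split=> //; apply: nc_equiv_trans nondeg0 rs0 _.
  by apply: realizes_equiv s0X sY _ => w; rewrite hX hY.
have [V [VE ->]] := sY _ _ doms.
have lim := contractive_pencil_limit Y_null isoA hY VE.
set B := \sum_i _ in lim *.
(* Passing from [b] to [b^t] reverses the words, as in [level]. *)
have level_rev m :
    \sum_(l < m) wsum l (fun w => hcoef b w *: wordmx (conj_tup A) w) =
    \sum_(l < m) wsum l (fun w => bt b w *: wordmx (conj_tup A) (rev w)).
  apply: eq_bigr => l _.
  exact: esym (wsum_rev l (fun w => hcoef b w *: wordmx (conj_tup A) w)).
have : 1%:M - zeta^* *: B \notin unitmx.
  apply: (singular_at_word_isometric (@complex_arch R) n_gt0 isoA _
    (onb_cons D_sqrt hb0 K_inv e_onb) _ (fun y => onb_free D_sqrt e_onb (y := y))).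
  - by rewrite /bt /Ut.
  - by move=> j; apply/l2_level_null/(onb_l2 D_sqrt e_onb).
  by move=> i j; apply: eq_null_seq (lim i j) => m; rewrite level_rev.
apply: contraR; rewrite /eigenvalue negbK kermx_eq0 row_free_unit => uB.
(* As [zeta] is unimodular, its conjugate is its inverse, so singularity of [1 - zeta^* B] is that
   of [B - zeta]. *)
have -> : 1%:M - zeta^* *: B = - zeta^* *: (B - zeta%:M).
  rewrite scalerBr scale_scalar_mx mulNr mulrC -normCK zeta1 expr1n.
  by rewrite scaleNr raddfN /= opprK addrC.
rewrite unitmxZ // unitfE oppr_eq0 conjC_eq0 -normr_eq0 zeta1.
exact: oner_neq0.
Qed.
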